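(* Let $c,d\ge 1$ be integers, let $(\mathbb X,\mathfrak A,\mu)$ be a probability space and $f:\mathbb X\to\mathbb X$ a measure-preserving map. Let $\mathcal A:\mathbb X\to \mathrm U(c,d)$ be a measurable map such that $x\mapsto \ln\|\mathcal A(x)\|$ is $\mu$-integrable. Then $$\int_0^1 L^{d}\big(f,\mathcal U^{(c,d)}_\theta\mathcal A\big)\,d\theta \;=\; \int_{\mathbb X} N_{d}(\mathcal A(x))\,d\mu(x),$$ where $\mathcal U^{(c,d)}_\theta\mathcal A$ denotes the map $x\mapsto \mathcal U^{(c,d)}_\theta\mathcal A(x)$.
   Context: $\mathrm U(c,d)=\{\mathcal T\in \mathrm{Mat}(c+d,\mathbb C): \mathcal T^*\mathcal G_{c,d}\mathcal T=\mathcal G_{c,d}\}$ with $\mathcal G_{c,d}=\begin{pmatrix}\mathbf 1_c&0\\0&-\mathbf 1_d\end{pmatrix}$, where $\mathbf 1_k$ is the $k\times k$ identity matrix. For $\theta\in[0,1]$, $\mathcal U^{(c,d)}_\theta=\begin{pmatrix}e^{2\pi i\theta}\mathbf 1_c&0\\0&\mathbf 1_d\end{pmatrix}\in \mathrm U(c,d)$. $f$ measure-preserving means $\int_{\mathbb X} g(f(x))\,d\mu(x)=\int_{\mathbb X} g(x)\,d\mu(x)$ for all $g\in L^1(d\mu)$ (not necessarily invertible). $\|\cdot\|$ is the operator norm, and $\sigma_1(\mathcal T)\ge\sigma_2(\mathcal T)\ge\dots$ are the singular values of a matrix $\mathcal T$. For a measurable invertible-matrix-valued map $\mathcal A$ on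 $\mathbb X$ with suitable log-integrability, put $\mathcal A_n(x)=\mathcal A(f^{n-1}(x))\cdots\mathcal A(f(x))\mathcal A(x)$. The Lyapunov exponents are $L_k(f,\mathcal A)=\lim_{n\to\infty}\frac1n\int_{\mathbb X}\ln\sigma_k(\mathcal A_n(x))\,d\mu(x)$, and $L^k(f,\mathcal A)=\sum_{j=1}^k L_j(f,\mathcal A)=\lim_{n\to\infty}\frac1n\int_{\mathbb X}\ln\|\Lambda^k\mathcal A_n(x)\|\,d\mu(x)$, where $\Lambda^k$ is the $k$-th exterior power. (For $\mathcal A$ with values in $\mathrm U(c,d)$ and $\ln\|\mathcal A(\cdot)\|\in L^1(d\mu)$ these limits exist.) For $\mathcal T\in \mathrm{GL}(m,\mathbb C)$ and $1\le r\le m$, $N_r(\mathcal T)=\sum_{i=1}^r\ln\left(\frac{\sigma_i(\mathcal T)+\sigma_i(\mathcal T)^{-1}}{2}\right)$. *)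

(* Defs.v *)
From HB Require Import structures.
From mathcomp Require Import all_boot all_order all_algebra.
From mathcomp Require Import complex.
From mathcomp Require Import all_classical all_reals all_analysis.

Set Implicit Arguments.
Unset Strict Implicit.
Unset Printing Implicit Defensive.

Import Order.TTheory GRing.Theory Num.Theory.
Import numFieldNormedType.Exports.

Local Open Scope classical_set_scope.
Local Open Scope ring_scope.
Local Open Scope sesquilinear_scope.

Section Matrices.
Context {R : realType}.

Definition Gform (c d : nat) : 'M[R[i]]_(c + d) := block_mx 1%:M 0 0 (- 1%:M).

Definition Ugroup (c d : nat) : set 'M[R[i]]_(c + d) :=
  [set T | T ^t* *m Gform c d *m T = Gform c d].

Definition expi2pi (t : R) : R[i] :=
  Complex (cos (2 * pi * t)) (sin (2 * pi * t)).

Definition Utheta (c d : nat) (t : R) : 'M[R[i]]_(c + d) :=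
  block_mx (expi2pi t)%:M 0 0 1%:M.

Definition l2norm (m : nat) (v : 'cV[R[i]]_m) : R :=
  Num.sqrt (\sum_i complex.Re `|v i 0| ^+ 2).

(* The library's norm on matrices is the maximum of the entries. *)
Definition opnorm (m : nat) (T : 'M[R[i]]_m) : R :=
  sup [set l2norm (T *m v) | v in [set v : 'cV[R[i]]_m | l2norm v <= 1]].

(* The square roots of the eigenvalues of T^* T, with multiplicity, in
   nonincreasing order. The entries of [spectral_diag (T ^t* *m T)] are real
   and nonnegative, so taking [complex.Re] loses nothing. *)
Definition singular_values (m : nat) (T : 'M[R[i]]_m) : seq R :=
  sort >=%R
    [seq Num.sqrt (complex.Re (spectral_diag (T ^t* *m T) 0 i)) | i : 'I_m].

(* Numbered from 1: meaningful for 1 <= k <= m. *)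
Definition sigma (m : nat) (k : nat) (T : 'M[R[i]]_m) : R :=
  nth 0 (singular_values T) k.-1.

Definition Nfun (m r : nat) (T : 'M[R[i]]_m) : R :=
  \sum_(1 <= j < r.+1) ln ((sigma j T + (sigma j T)^-1) / 2).

End Matrices.

Arguments Ugroup {R} c d _.

Section Cocycles.
Context {R : realType} {disp : measure_display} {X : measurableType disp}.
Implicit Types (f : X -> X) (mu : {measure set X -> \bar R}).

(* Not assumed invertible. *)
Definition measure_preserving mu f : Prop :=
  measurable_fun [set: X] f /\
  forall g : X -> R, mu.-integrable [set: X] (EFin \o g) ->
    (\int[mu]_x (g (f x))%:E = \int[mu]_x (g x)%:E)%E.

(* Measurability for the Borel sigma-algebra of Mat(m, C) = R^(2 m^2). *)
Definition measurable_mx (m : nat) (A : X -> 'M[R[i]]_m) : Prop :=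
  forall i j, measurable_fun [set: X] (fun x => complex.Re (A x i j)) /\
              measurable_fun [set: X] (fun x => complex.Im (A x i j)).

Fixpoint cocycle (m : nat) f (A : X -> 'M[R[i]]_m) (n : nat) (x : X) :
    'M[R[i]]_m :=
  if n is n'.+1 then A (iter n' f x) *m cocycle f A n' x else 1%:M.

Definition lyap (m : nat) mu f (A : X -> 'M[R[i]]_m) (k : nat) : \bar R :=
  limn (fun n : nat =>
    ((n%:R^-1)%:E * \int[mu]_x (ln (sigma k (cocycle f A n x)))%:E)%E).

Definition lyap_sum (m : nat) mu f (A : X -> 'M[R[i]]_m) (k : nat) : \bar R :=
  (\sum_(1 <= j < k.+1) lyap mu f A j)%E.

End Cocycles.

(* Main.v *)
(** Average the logarithm of the lower right minor of the cocycle rather than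
    its singular values.  For [T] in [U(c, d)] with lower right [d x d] block
    [D], the spectrum of [H = T^* T] is invariant under inversion and
    [1 + H = G T^-1 (G T + T G)], which gives [N_d(T) = ln |det D|]; this
    differs from the sum of the [d] largest [ln sigma_i] by at most [d ln 2],
    so that [L^d] is the limit of [1/n] times the integral of
    [ln |det D_n|], [D_n] being the block of the [n]-th iterate.

    Replacing [e^(2 pi i theta)] by a complex number [z], [det D_n] becomes a
    polynomial in [z].  If [|z| <= 1], each factor does not increase the
    indefinite form, so no vector [(0, w)], on which the form is negative, is
    sent to a vector [(_, 0)]: the polynomial has no zero in the closed disk,
    and its logarithmic mean over the circle is its value at [z = 0], namely
    the sum of the [ln |det D(A(f^k x))| = N_d(A(f^k x))].  Tonelli's theorem,
    the invariance of [mu] and dominated convergence conclude.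

    The limits defining the individual exponents exist by Fekete's lemma,
    applied to the sum of the moduli of all [j]-minors: it is submultiplicative
    by the Cauchy-Binet formula and comparable to [sigma_1 ... sigma_j]. *)
Require Import Defs.
From HB Require Import structures.
From mathcomp Require Import all_boot all_order all_algebra fingroup perm.
From mathcomp Require Import complex.
From mathcomp Require Import all_classical all_reals all_analysis.
From mathcomp Require Import measurable_realfun ring lra zify.

Set Implicit Arguments.
Unset Strict Implicit.
Unset Printing Implicit Defensive.

Import Order.TTheory GRing.Theory Num.Theory.
Import numFieldNormedType.Exports.

Local Open Scope classical_set_scope.
Local Open Scope ring_scope.
Local Open Scope sesquilinear_scope.

(** * Cauchy-Binet formula and traces of exterior powers *)

Section Minors.
Variable F : comNzRingType.

(** The determinant is multilinear in the rows of [A *m B], and these are combinations of the rows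
    of [B]. All maps [g] are kept: a noninjective one repeats a row of [B] and contributes zero. *)
Lemma det_mulmx_expand (j m : nat) (A : 'M[F]_(j, m)) (B : 'M[F]_(m, j)) :
  \det (A *m B) =
    \sum_(g : {ffun 'I_j -> 'I_m}) (\prod_i A i (g i)) * \det (mxsub g id B).
Proof.
transitivity (\sum_(s : 'S_j) \sum_(g : {ffun 'I_j -> 'I_m})
   (-1) ^+ s * \prod_i (A i (g i) * B (g i) (s i))).
  apply: eq_bigr => s _; rewrite -big_distrr /=; congr (_ * _).
  rewrite -(bigA_distr_bigA (fun i k => A i k * B k (s i))) /=.
  by apply: eq_bigr => i _; rewrite mxE.
rewrite exchange_big /=; apply: eq_bigr => g _.
rewrite /determinant big_distrr /=; apply: eq_bigr => s _.
rewrite big_split /= mulrCA; congr (_ * (_ * _)).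
by apply: eq_bigr => i _; rewrite mxE.
Qed.

(* Averaging the expansion above over the relabellings of [g] by permutations
   turns the products into minors. *)
Lemma det_mulmx_minors (j m : nat) (A : 'M[F]_(j, m)) (B : 'M[F]_(m, j)) :
  \det (A *m B) *+ j`! =
    \sum_(g : {ffun 'I_j -> 'I_m}) \det (mxsub id g A) * \det (mxsub g id B).
Proof.
have key (s : 'S_j) : \det (A *m B) =
    \sum_(g : {ffun 'I_j -> 'I_m})
      ((-1) ^+ s * \prod_i A i (g (s i))) * \det (mxsub g id B).
  rewrite det_mulmx_expand.
  pose h (t : 'S_j) (g : {ffun 'I_j -> 'I_m}) : {ffun 'I_j -> 'I_m} :=
    [ffun i => g (t i)].
  have hbij : bijective (h s).
    by exists (h s^-1%g) => g; apply/ffunP => i; rewrite !ffunE ?permKV ?permK.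
  rewrite (reindex (h s)) /=; last exact: onW_bij.
  apply: eq_bigr => g _.
  have -> : mxsub (h s g) id B = row_perm s (mxsub g id B).
    by apply/matrixP => a b; rewrite !mxE ffunE.
  rewrite row_permE det_mulmx det_perm [(-1) ^+ s * _]mulrC -!mulrA.
  by congr (_ * _); apply: eq_bigr => i _; rewrite ffunE.
have -> : \det (A *m B) *+ j`! = \sum_(s : 'S_j) \det (A *m B).
  by rewrite sumr_const card_Sn.
rewrite (eq_bigr _ (fun s _ => key s)) exchange_big /=.
apply: eq_bigr => g _; rewrite -big_distrl /=; congr (_ * _).
by apply: eq_bigr => s _; congr (_ * _); apply: eq_bigr => i _; rewrite mxE.
Qed.

(** Cauchy-Binet formula. Summing over all maps [g] rather than increasing ones counts each product
    of minors once per ordering of its index set, whence the factorial on the left. *)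
Lemma minor_mulmx (j m n p : nat) (f : 'I_j -> 'I_m) (h : 'I_j -> 'I_p)
    (A : 'M[F]_(m, n)) (B : 'M[F]_(n, p)) :
  \det (mxsub f h (A *m B)) *+ j`! =
    \sum_(g : {ffun 'I_j -> 'I_n}) \det (mxsub f g A) * \det (mxsub g h B).
Proof.
have -> : mxsub f h (A *m B) = mxsub f id A *m mxsub id h B.
  by apply/matrixP => a b; rewrite !mxE; apply: eq_bigr => k _; rewrite !mxE.
rewrite det_mulmx_minors; apply: eq_bigr => g _.
by congr (_ * _); congr (determinant _); apply/matrixP => a b; rewrite !mxE.
Qed.

(* Up to the factor [j`!], the trace of the [j]-th exterior power. *)
Definition extr (j m : nat) (H : 'M[F]_m) : F :=
  \sum_(f : {ffun 'I_j -> 'I_m}) \det (mxsub f f H).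

(** Cyclicity of the trace on the exterior power: both sides expand into the same double sum with
    [f] and [g] exchanged. The factorial stays because [F] may have positive characteristic. *)
Lemma extr_mulC (j m : nat) (A B : 'M[F]_m) :
  extr j (A *m B) *+ j`! = extr j (B *m A) *+ j`!.
Proof.
rewrite /extr -!sumrMnl.
under eq_bigr do rewrite minor_mulmx.
under [RHS]eq_bigr do rewrite minor_mulmx.
rewrite exchange_big /=; apply: eq_bigr => f _.
by apply: eq_bigr => g _; rewrite mulrC.
Qed.

Lemma minor_diag (j m : nat) (f : 'I_j -> 'I_m) (s : 'rV[F]_m) :
  \det (mxsub f f (diag_mx s)) = if injectiveb f then \prod_i s 0 (f i) else 0.
Proof.
case: ifPn => [/injectiveP finj|/injectivePn[a [b ab fab]]].
  have -> : mxsub f f (diag_mx s) = diag_mx (\row_i s 0 (f i)).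
    by apply/matrixP => a b; rewrite !mxE (inj_eq finj).
  by rewrite det_diag; apply: eq_bigr => i _; rewrite mxE.
by apply: (determinant_alternate ab) => k; rewrite !mxE fab.
Qed.

Lemma extr_diag (j m : nat) (s : 'rV[F]_m) :
  extr j (diag_mx s) =
    \sum_(f : {ffun 'I_j -> 'I_m} | injectiveb f) \prod_i s 0 (f i).
Proof.
by rewrite /extr [RHS]big_mkcond; apply: eq_bigr => f _; rewrite minor_diag.
Qed.

End Minors.

Lemma extr_similar (C : numFieldType) (j m : nat) (P H : 'M[C]_m) :
  P \in unitmx -> extr j (invmx P *m H *m P) = extr j H.
Proof.
move=> uP; apply: (@pmulrnI _ j`! _); first exact: fact_gt0.
by rewrite extr_mulC mulmxA mulmxV // mul1mx.
Qed.

(** Induction on the cardinality, comparing the factor of largest index in [A] with the last factor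
    on the right. *)
Lemma prod_subset_le (R : realFieldType) (s : nat -> R) (m : nat)
    (A : {set 'I_m}) :
  (forall a b, (a <= b < m)%N -> s b <= s a) ->
  (forall a, (a < m)%N -> 0 <= s a) ->
  \prod_(i in A) s i <= \prod_(i < #|A|) s i.
Proof.
move=> smono s0; have [k] := ubnP #|A|; elim: k A => // k IH A.
rewrite ltnS => Ak; case: (set_0Vmem A) => [->|[a aA]].
  by rewrite cards0 big_ord0 big_set0.
have [i0 i0A imax] := @arg_maxnP _ a (fun i => i \in A) (@nat_of_ord m) aA.
rewrite (big_setD1 i0) //= (cardsD1 i0 A) i0A add1n big_ord_recr /= mulrC.
(* The other members of [A] all lie strictly below the largest one [i0], so there are at most [i0]
   of them. *)
have AI : (#|A :\ i0| <= i0)%N.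
  pose w := widen_ord (ltnW (ltn_ord i0)).
  have winj : injective w by move=> x y /(congr1 val) /= /val_inj.
  rewrite -[leqRHS](card_ord i0) -[leqRHS](card_imset _ winj).
  apply/subset_leq_card/fintype.subsetP => b; rewrite !inE => /andP[bi0 bA].
  have bi : (b < i0)%N by rewrite ltn_neqAle bi0 /=; exact: imax.
  by apply/imsetP; exists (Ordinal bi) => //; apply/val_inj.
apply: ler_pM.
- by apply: prodr_ge0 => i _; exact: s0.
- exact: s0.
- by apply: IH; rewrite (cardsD1 i0) i0A in Ak.
- by apply: smono; rewrite AI /=.
Qed.

Lemma prod_injective_le (R : realFieldType) (s : nat -> R) (j m : nat)
    (f : 'I_j -> 'I_m) :
  (forall a b, (a <= b < m)%N -> s b <= s a) ->
  (forall a, (a < m)%N -> 0 <= s a) -> injective f ->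
  \prod_i s (f i) <= \prod_(i < j) s i.
Proof.
move=> smono s0 finj.
have := prod_subset_le (f @: [set: 'I_j])%SET smono s0.
rewrite card_imset // cardsT card_ord big_imset /=; last by move=> ? ? _ _ /finj.
by rewrite (eq_bigl predT) // => i; rewrite inE.
Qed.

(** Serves to reorder a diagonalization so that the eigenvalues follow the order of the sorted
    singular values. *)
Lemma similar_diag_perm (F : fieldType) (n : nat) (P : 'M[F]_n) (p : 'S_n)
    (s : 'rV[F]_n) : P \in unitmx ->
  invmx P *m diag_mx s *m P =
  invmx (perm_mx p *m P) *m diag_mx (\row_i s 0 (p i)) *m (perm_mx p *m P).
Proof.
move=> uP; set Q := perm_mx p *m P; have uQ : Q \in unitmx.
  by rewrite unitmx_mul unitmx_perm.
apply: (can_inj (mulKmx uQ)); rewrite -[in RHS]mulmxA mulKVmx // /Q.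
rewrite -!mulmxA mulKVmx // !mulmxA; congr (_ *m _).
rewrite -row_permE -[p in RHS]invgK -col_permE.
apply/matrixP => i k; rewrite !mxE invgK.
by rewrite -(inj_eq (@perm_inj _ p) i) permKV.
Qed.

Lemma similar_diag_exp (F : fieldType) (n p : nat) (P : 'M[F]_n) (s : 'rV[F]_n) :
  P \in unitmx ->
  (invmx P *m diag_mx s *m P) ^+ p =
  invmx P *m diag_mx (\row_i (s 0 i) ^+ p) *m P.
Proof.
move=> uP; elim: p => [|p IH].
  rewrite expr0 (_ : diag_mx _ = 1%:M) ?mulmx1 ?mulVmx //.
  by apply/matrixP => a b; rewrite !mxE expr0.
rewrite exprS IH -mulmxE -!mulmxA mulKVmx // !mulmxA; congr (_ *m _).
rewrite -mulmxA mulmx_diag; congr (_ *m _); congr diag_mx.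
by apply/rowP => a; rewrite !mxE exprS.
Qed.

(** * Singular values and diagonalization of the Gram matrix *)

Section SingularValues.
Context {R : realType}.
Local Notation C := R[i].

Lemma size_singular_values (m : nat) (T : 'M[C]_m) :
  size (singular_values T) = m.
Proof. by rewrite size_sort size_map -cardE card_ord. Qed.

Lemma sigma_ge0 (m k : nat) (T : 'M[C]_m) : 0 <= sigma k T.
Proof.
rewrite /sigma; have [km|mk] := ltnP k.-1 (size (singular_values T)).
  have := mem_nth 0 km; rewrite mem_sort => /mapP[i _ ->].
  exact: sqrtr_ge0.
by rewrite nth_default.
Qed.

Lemma sigma_noninc (m : nat) (T : 'M[C]_m) (a b : nat) :
  (a <= b < m)%N -> sigma b.+1 T <= sigma a.+1 T.
Proof.
move=> /andP[ab bm]; rewrite /sigma /=.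
have srt : sorted >=%R (singular_values T).
  by apply: sort_sorted => x y; exact: le_total.
by apply: (sorted_leq_nth ge_trans ge_refl 0 srt) => //;
  rewrite inE size_singular_values // (leq_ltn_trans ab).
Qed.

Lemma gram_entry_ge0 (m n : nat) (B : 'M[C]_(m, n)) (i : 'I_n) :
  0 <= (B ^t* *m B) i i.
Proof.
rewrite mxE; apply: sumr_ge0 => k _.
by rewrite !mxE mulrC mul_conjC_ge0.
Qed.

Lemma gram_normal (m n : nat) (T : 'M[C]_(m, n)) : T ^t* *m T \is normalmx.
Proof.
by apply/normalmxP; rewrite trmx_mul map_mxM /= trmxCK.
Qed.

(** An eigenvalue of [T ^t* *m T] is a diagonal entry of the Gram matrix of [T *m P ^t*], with [P]
    the unitary diagonalizing matrix. *)
Lemma gram_spectral_ge0 (m : nat) (T : 'M[C]_m) (i : 'I_m) :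
  0 <= spectral_diag (T ^t* *m T) 0 i.
Proof.
have /orthomx_spectralP := gram_normal T.
set P := spectralmx _; set s := spectral_diag _ => TE.
have uP : P \is unitarymx by exact: spectral_unitarymx.
have -> : s 0 i = ((T *m P ^t*) ^t* *m (T *m P ^t*)) i i.
  rewrite trmx_mul map_mxM /= trmxCK mulmxA -(mulmxA P) TE invmx_unitary //.
  rewrite !mulmxA (unitarymxP uP) mul1mx -mulmxA (unitarymxP uP) mulmx1.
  by rewrite mxE eqxx mulr1n.
exact: gram_entry_ge0.
Qed.

(** The bridge from the sorted list to linear algebra. Only the invertibility of [P] is recorded: it
    suffices for determinants, ranks, characteristic polynomials and the traces [extr]. *)
Lemma gram_similar_diag (m : nat) (T : 'M[C]_m) :
  exists2 P : 'M[C]_m, P \in unitmx &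
    T ^t* *m T =
      invmx P *m diag_mx (\row_i ((sigma i.+1 T) ^+ 2)%:C%C) *m P.
Proof.
have /orthomx_spectralP := gram_normal T.
set P := spectralmx _; set s := spectral_diag _ => TE.
have uP : P \in unitmx by exact: spectral_unit.
pose t := [tuple Num.sqrt (complex.Re (s 0 i)) | i < m].
have szs : size (singular_values T) == m by rewrite size_singular_values.
have : perm_eq (Tuple szs) t.
  by rewrite /= /singular_values perm_sort /image_mem enumT.
case/tuple_permP => p pE.
have sE (i : 'I_m) : ((sigma i.+1 T) ^+ 2)%:C%C = s 0 (p i).
  have -> : sigma i.+1 T = Num.sqrt (complex.Re (s 0 (p i))).
    rewrite /sigma /=; move: pE => /= ->.
    by rewrite -(tnth_nth 0 [tuple tnth t (p k) | k < m] i) !tnth_mktuple.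
  have s0 := gram_spectral_ge0 T (p i).
  rewrite sqr_sqrtr ?RRe_real ?ger0_real //.
  by move: s0; rewrite lecE => /andP[].
exists (perm_mx p *m P).
  by rewrite unitmx_mul unitmx_perm.
apply: (etrans TE); apply: (etrans (@similar_diag_perm C m P p s uP)).
congr (_ *m diag_mx _ *m _).
by apply/rowP => i; rewrite !mxE sE.
Qed.
End SingularValues.

Notation normc := ComplexField.Normc.normc.

(** * Products of singular values compared with minors *)

Section ExteriorTraces.
Context {R : realType}.
Local Notation C := R[i].

Lemma normc_normr (z : C) : (normc z)%:C%C = `|z|.
Proof. by rewrite normc_def; case: z. Qed.

Lemma normc_ge0 (z : C) : 0 <= normc z.
Proof. by case: z => a b; exact: sqrtr_ge0. Qed.

Lemma normc_eq0 (z : C) : (normc z == 0) = (z == 0).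
Proof. by rewrite -[RHS]normr_eq0 -normc_normr -(inj_eq (@complexI R)). Qed.

Lemma normc_sum (I : finType) (F : I -> C) :
  normc (\sum_i F i) <= \sum_i normc (F i).
Proof.
rewrite -lecR rmorph_sum /= normc_normr; apply: le_trans (ler_norm_sum _ _ _) _.
by apply: ler_sum => i _; rewrite normc_normr.
Qed.

Lemma normc_sqr (z : C) : ((normc z) ^+ 2)%:C%C = z^* * z.
Proof. by rewrite rmorphXn /= normc_normr normCK mulrC. Qed.

(** For [j <= m], the operator norm of the [j]-th exterior power of [T]. *)
Definition sigma_prod (m j : nat) (T : 'M[C]_m) : R := \prod_(i < j) sigma i.+1 T.

Lemma sigma_prod_ge0 (m j : nat) (T : 'M[C]_m) : 0 <= sigma_prod j T.
Proof. by apply: prodr_ge0 => i _; exact: sigma_ge0. Qed.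

(** The power [p] is there for measurability: as [p] grows, the root of order [2 * p] of this trace
    tends to [sigma_prod j T]. The comparison with minors uses [p = 1]. *)
Lemma extr_gram_pow (m j p : nat) (T : 'M[C]_m) :
  extr j ((T ^t* *m T) ^+ p) =
  (\sum_(f : {ffun 'I_j -> 'I_m} | injectiveb f)
      \prod_i ((sigma (f i).+1 T) ^+ 2) ^+ p)%:C%C.
Proof.
have [P uP ->] := gram_similar_diag T.
set s := \row_i _.
rewrite similar_diag_exp // extr_similar // extr_diag rmorph_sum /=; apply: eq_bigr => f _.
by rewrite rmorph_prod; apply: eq_bigr => i _; rewrite !mxE !rmorphXn.
Qed.

Lemma sigma_prod_sqr_pow (m j p : nat) (T : 'M[C]_m) :
  \prod_(i < j) ((sigma i.+1 T) ^+ 2) ^+ p = (sigma_prod j T) ^+ (2 * p).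
Proof. by rewrite /sigma_prod -prodrXl; apply: eq_bigr => i _; rewrite exprM. Qed.

Lemma extr_gram_ge (m j p : nat) (T : 'M[C]_m) : (j <= m)%N ->
  (sigma_prod j T) ^+ (2 * p) <= complex.Re (extr j ((T ^t* *m T) ^+ p)).
Proof.
move=> jm; rewrite extr_gram_pow /= -sigma_prod_sqr_pow.
pose w := widen_ord jm.
have winj : injective w by move=> x y /(congr1 val) /= /val_inj.
(* Among the nonnegative terms, the one of the inclusion of the first [j] indices is already the
   left-hand side. *)
rewrite (bigD1 [ffun i => w i]) /=; last first.
  by apply/injectiveP => a b; rewrite !ffunE => /winj.
under [X in _ <= X + _]eq_bigr do rewrite ffunE.
rewrite lerDl; apply: sumr_ge0 => f _; apply: prodr_ge0 => i _.
by rewrite !exprn_ge0 ?sigma_ge0.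
Qed.

Lemma extr_gram_le (m j p : nat) (T : 'M[C]_m) :
  complex.Re (extr j ((T ^t* *m T) ^+ p)) <= (m ^ j)%:R * (sigma_prod j T) ^+ (2 * p).
Proof.
rewrite extr_gram_pow /= -sigma_prod_sqr_pow.
apply: (@le_trans _ _ (\sum_(f : {ffun 'I_j -> 'I_m})
   \prod_(i < j) (sigma i.+1 T ^+ 2) ^+ p)).
  rewrite big_mkcond; apply: ler_sum => f _; case: ifPn => [/injectiveP finj|_].
    apply: (prod_injective_le (s := fun i => (sigma i.+1 T ^+ 2) ^+ p)) finj.
      by move=> a b abm; rewrite /= -!exprM lerXn2r ?nnegrE ?sigma_ge0 ?sigma_noninc.
    by move=> a _; rewrite !exprn_ge0 ?sigma_ge0.
  by apply: prodr_ge0 => i _; rewrite !exprn_ge0 ?sigma_ge0.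
by rewrite sumr_const card_ffun !card_ord mulr_natl.
Qed.

(** Up to a constant factor, the sum of the moduli of the entries of the [j]-th exterior power.
    Running over all maps keeps it submultiplicative with constant 1. *)
Definition minorsum (m j : nat) (T : 'M[C]_m) : R :=
  \sum_(f : {ffun 'I_j -> 'I_m}) \sum_(g : {ffun 'I_j -> 'I_m})
    normc (\det (mxsub f g T)).

Lemma minorsum_ge0 (m j : nat) (T : 'M[C]_m) : 0 <= minorsum j T.
Proof. by do 2 apply: sumr_ge0 => ? _; exact: normc_ge0. Qed.

Lemma minorsum_mulmx (m j : nat) (A B : 'M[C]_m) :
  minorsum j (A *m B) <= minorsum j A * minorsum j B.
Proof.
apply: (@le_trans _ _ (\sum_(f : {ffun 'I_j -> 'I_m})
    \sum_(h : {ffun 'I_j -> 'I_m}) \sum_(g : {ffun 'I_j -> 'I_m})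
    normc (\det (mxsub f g A)) * normc (\det (mxsub g h B)))).
  apply: ler_sum => f _; apply: ler_sum => h _.
  (* The factorial in Cauchy-Binet is at least 1, so inserting it only enlarges the left-hand
     side. *)
  apply: (@le_trans _ _ (normc (\det (mxsub f h (A *m B)) *+ j`!))).
    rewrite normcMn -[leLHS]mulr1n; apply: ler_wpMn2l.
      exact: normc_ge0.
    exact: fact_gt0.
  rewrite minor_mulmx; apply: le_trans (normc_sum _) _.
  by apply: ler_sum => g _; rewrite ComplexField.Normc.normcM.
rewrite /minorsum big_distrl /=; apply: ler_sum => f _.
rewrite exchange_big big_distrl /=; apply: ler_sum => g _.
rewrite -big_distrr /=; apply: ler_wpM2l; first exact: normc_ge0.
by rewrite [leRHS](bigD1 g) //= lerDl; do 2 apply: sumr_ge0 => ? _;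
  exact: normc_ge0.
Qed.

(** Cauchy-Binet for [T ^t* *m T], where each minor of [T] meets its own conjugate: this is the
    squared Hilbert-Schmidt norm of the exterior power, up to a factor. *)
Lemma extr_gram_minors (m j : nat) (T : 'M[C]_m) :
  complex.Re (extr j (T ^t* *m T)) *+ j`! =
  \sum_(f : {ffun 'I_j -> 'I_m}) \sum_(g : {ffun 'I_j -> 'I_m})
    normc (\det (mxsub f g T)) ^+ 2.
Proof.
apply: complexI; rewrite rmorphMn /= rmorph_sum /=.
have /RRe_real -> : extr j (T ^t* *m T) \is Num.real.
  have := extr_gram_pow j 1 T; rewrite expr1 => ->.
  by apply/complex_realP; eexists.
rewrite /extr -sumrMnl.
transitivity (\sum_(f : {ffun 'I_j -> 'I_m}) \sum_(g : {ffun 'I_j -> 'I_m})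
    \det (mxsub f g (T ^t*)) * \det (mxsub g f T)).
  by apply: eq_bigr => f _; exact: (@minor_mulmx C).
rewrite exchange_big /=; apply: eq_bigr => g _.
rewrite rmorph_sum /=; apply: eq_bigr => f _.
rewrite normc_sqr -det_map_mx -det_tr; congr (_ * _); congr (determinant _).
by apply/matrixP => a b; rewrite !mxE.
Qed.

(** The square of [sigma_prod] is at most the sum of the squared moduli of the minors, itself at
    most the square of their sum. *)
Lemma sigma_prod_le_minorsum (m j : nat) (T : 'M[C]_m) : (j <= m)%N ->
  sigma_prod j T <= minorsum j T.
Proof.
move=> jm; rewrite -(@ler_pXn2r _ 2) ?nnegrE ?sigma_prod_ge0 ?minorsum_ge0 //.
have := extr_gram_ge 1 T jm; rewrite expr1 muln1 => /le_trans; apply.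
apply: (@le_trans _ _ (complex.Re (extr j (T ^t* *m T)) *+ j`!)).
  rewrite -[leLHS]mulr1n; apply: ler_wpMn2l; last exact: fact_gt0.
  have := extr_gram_ge 1 T jm; rewrite expr1; apply: le_trans.
  by rewrite exprn_ge0 ?sigma_prod_ge0.
rewrite extr_gram_minors expr2 {2}/minorsum big_distrr /=.
apply: ler_sum => f _; rewrite big_distrr /=; apply: ler_sum => g _.
rewrite expr2 ler_wpM2r ?normc_ge0 // /minorsum.
rewrite (bigD1 f) //= (bigD1 g) //= -addrA lerDl addr_ge0 ?sumr_ge0 //.
  by move=> *; exact: normc_ge0.
by move=> *; apply: sumr_ge0 => *; exact: normc_ge0.
Qed.

Lemma minorsum_le_sigma_prod (m j : nat) : exists2 K : R, 0 < K &
  forall T : 'M[C]_m, minorsum j T <= K * sigma_prod j T.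
Proof.
pose N := (#|{ffun 'I_j -> 'I_m}| * #|{ffun 'I_j -> 'I_m}|)%N.
(* [N] counts the pairs of maps and the square root bounds each minor relative to [sigma_prod]; the
   final 1 keeps [K] positive even for [m = 0], so that [ln K] can be used. *)
pose K : R := N.+1%:R * Num.sqrt ((m ^ j)%:R *+ j`!) + 1.
exists K => [|T]; first by rewrite ltr_wpDl // mulr_ge0 ?sqrtr_ge0.
have entry (f g : {ffun 'I_j -> 'I_m}) :
    normc (\det (mxsub f g T)) <= Num.sqrt ((m ^ j)%:R *+ j`!) * sigma_prod j T.
  rewrite -(@ler_pXn2r _ 2) ?nnegrE ?normc_ge0 ?mulr_ge0 ?sqrtr_ge0 ?sigma_prod_ge0 //.
  rewrite exprMn sqr_sqrtr ?mulrn_wge0 //.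
  apply: (@le_trans _ _ (complex.Re (extr j (T ^t* *m T)) *+ j`!)).
    rewrite extr_gram_minors (bigD1 f) //= (bigD1 g) //= -addrA lerDl addr_ge0 ?sumr_ge0 //.
      by move=> *; rewrite exprn_ge0 ?normc_ge0.
    by move=> *; apply: sumr_ge0 => *; rewrite exprn_ge0 ?normc_ge0.
  rewrite mulrnAl; apply: ler_wMn2r.
  by have := extr_gram_le j 1 T; rewrite expr1 muln1.
apply: (@le_trans _ _ (N%:R * (Num.sqrt ((m ^ j)%:R *+ j`!) * sigma_prod j T))).
  rewrite /minorsum /N natrM -mulrA mulr_natl -sumr_const; apply: ler_sum => f _.
  by rewrite mulr_natl -sumr_const; apply: ler_sum => g _.
rewrite mulrA ler_wpM2r ?sigma_prod_ge0 // /K.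
by rewrite ler_wpDr // ler_wpM2r ?sqrtr_ge0 // ler_nat.
Qed.

End ExteriorTraces.

(** The square submatrix indexed by [A] is diagonal and invertible. *)
Lemma rank_diag_ge (F : fieldType) (n : nat) (v : 'rV[F]_n) (A : {set 'I_n}) :
  (forall i, i \in A -> v 0 i != 0) -> (#|A| <= \rank (diag_mx v))%N.
Proof.
move=> vA; pose f (k : 'I_#|A|) : 'I_n := enum_val k.
have finj : injective f by exact: enum_val_inj.
have u : mxsub f f (diag_mx v) \in unitmx.
  rewrite unitmxE minor_diag; case: injectiveP => // _.
  by rewrite unitfE; apply/prodf_neq0 => k _; apply: vA; exact: enum_valP.
rewrite -[leqLHS](mxrank_unit u).
have -> : mxsub f f (diag_mx v) =
    rowsub f 1%:M *m diag_mx v *m colsub f 1%:M.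
  by rewrite -rowsubE mulmx_colsub mulmx1; apply/matrixP => a b; rewrite !mxE.
by rewrite (leq_trans (mxrankM_maxl _ _)) ?mxrankM_maxr.
Qed.

(** * Determinant identities for matrices preserving the indefinite form *)

Section IndefiniteUnitary.
Context {R : realType} {c d : nat}.
Local Notation C := R[i].
Local Notation G := (@Gform R c d).
Local Notation m := (c + d)%N.

Lemma GformK : G *m G = 1%:M.
Proof.
rewrite /Gform mulmx_block !mul0mx !mulmx0 !addr0 add0r mul1mx.
by rewrite mulNmx mul1mx opprK scalar_mx_block.
Qed.

Lemma Gform_unit : G \in unitmx.
Proof. by case/mulmx1_unit: GformK. Qed.

Variable T : 'M[C]_m.
Hypothesis hT : Ugroup c d T.

Lemma Ugroup_unit : T \in unitmx.
Proof.
have : G *m T ^t* *m G *m T = 1%:M by rewrite -!mulmxA (mulmxA (T ^t* )) hT GformK.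
by case/mulmx1_unit.
Qed.

Lemma Ugroup_inv : invmx T = G *m T ^t* *m G.
Proof.
apply: (can_inj (mulmxK Ugroup_unit)); rewrite mulVmx ?Ugroup_unit //.
by rewrite -!mulmxA (mulmxA (T ^t* )) hT GformK.
Qed.

Lemma Ugroup_tC : T ^t* = G *m invmx T *m G.
Proof. by rewrite Ugroup_inv !mulmxA GformK mul1mx -mulmxA GformK mulmx1. Qed.

Lemma Ugroup_tC_mul : T *m G *m T ^t* = G.
Proof. by rewrite Ugroup_tC !mulmxA -(mulmxA T) GformK mulmx1 mulmxV ?mul1mx // Ugroup_unit. Qed.

Lemma normc_det_tC (n : nat) (A : 'M[C]_n) : normc (\det (A ^t* )) = normc (\det A).
Proof.
by apply: complexI; rewrite !normc_normr det_map_mx det_tr norm_conjC.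
Qed.

Lemma Ugroup_det : normc (\det T) = 1.
Proof.
have := congr1 (fun M => normc (\det M)) hT.
rewrite /= !det_mulmx !ComplexField.Normc.normcM normc_det_tC mulrAC => /eqP.
rewrite -subr_eq0 -{2}[normc (\det G)]mul1r -mulrBl mulf_eq0.
have /negPf -> : normc (\det G) != 0.
  by rewrite normc_eq0 -unitfE -unitmxE Gform_unit.
rewrite orbF subr_eq0 -expr2 sqrp_eq1 ?normc_ge0 //; exact: eqP.
Qed.

(** Jacobi's identity on complementary minors: the upper left minor of [T] is [\det T] times the
    lower right minor of its inverse, and the lower right block of the inverse is the adjoint of
    that of [T]. *)
Lemma Ugroup_det_blocks : normc (\det (ulsubmx T)) = normc (\det (drsubmx T)).
Proof.
set S := invmx T.
have Sdr : drsubmx S = (drsubmx T) ^t*.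
  rewrite /S Ugroup_inv /Gform -{1}[T ^t*]submxK !mulmx_block.
  rewrite !mul0mx !mulmx0 !addr0 !add0r block_mxKdr.
  rewrite mulNmx mul1mx mulmxN mulmx1 opprK.
  by apply/matrixP => i k; rewrite !mxE.
(* The right columns of [V] are those of the inverse of [T], so those of [T *m V] are columns of the
   identity. *)
pose V : 'M[C]_m := block_mx 1%:M (ursubmx S) 0 (drsubmx S).
have TV : T *m V = block_mx (ulsubmx T) 0 (dlsubmx T) 1%:M.
  have := mulmxV Ugroup_unit.
  rewrite -/S -{1}(submxK T) -{1}(submxK S) mulmx_block.
  rewrite scalar_mx_block => /eq_block_mx[_ e1 _ e2].
  by rewrite -{1}(submxK T) /V mulmx_block e1 e2 !mulmx1 !mulmx0 !addr0.
have := congr1 (fun M => normc (\det M)) TV.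
rewrite /= det_mulmx det_lblock det_ublock !det1 !mul1r mulr1.
by rewrite ComplexField.Normc.normcM Ugroup_det mul1r Sdr normc_det_tC => ->.
Qed.

Lemma Ugroup_det_1gram : normc (\det (1%:M + T ^t* *m T)) =
  2 ^+ m * normc (\det (drsubmx T)) ^+ 2.
Proof.
(* The product is [T *m G + G *m T], in which the off-diagonal blocks cancel and the diagonal ones
   double. *)
have E : T *m G *m (1%:M + T ^t* *m T) =
    block_mx (2%:R *: ulsubmx T) 0 0 (- (2%:R *: drsubmx T)).
  rewrite mulmxDr mulmx1 mulmxA Ugroup_tC_mul -{1 2}[T]submxK /Gform.
  rewrite !mulmx_block !mul0mx !mulmx0 !addr0 !add0r mulmxN mulmx1 mulNmx.
  rewrite !mul1mx !mulmx1 !mulmxN !mulmx1 !mulNmx !mul1mx.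
  rewrite add_block_mx subrr addNr.
  by rewrite -opprD !scaler_nat !mulr2n.
have := congr1 (fun M => normc (\det M)) E.
rewrite /= [X in _ = normc X -> _]det_ublock !det_mulmx !ComplexField.Normc.normcM Ugroup_det.
have -> : normc (\det G) = 1.
  have := congr1 (fun M => normc (\det M)) GformK.
  rewrite /= det_mulmx det1 ComplexField.Normc.normcM ComplexField.Normc.normc1.
  by move/eqP; rewrite -expr2 sqrp_eq1 ?normc_ge0 // => /eqP.
rewrite !mul1r => ->; rewrite -scaleNr !detZ !ComplexField.Normc.normcM.
have nX (x : C) k : normc (x ^+ k) = normc x ^+ k.
  elim: k => [|k IH]; first by rewrite !expr0 ComplexField.Normc.normc1.
  by rewrite !exprS ComplexField.Normc.normcM IH.
have n2 : normc (2%:R : C) = 2.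
  by apply: complexI; rewrite normc_normr normr_nat rmorph_nat.
rewrite !nX normcN n2 Ugroup_det_blocks exprD; ring.
Qed.

End IndefiniteUnitary.

(** * Determinants and characteristic polynomials through singular values *)

Lemma char_poly_similar (F : fieldType) (n : nat) (P A : 'M[F]_n) :
  P \in unitmx -> char_poly (invmx P *m A *m P) = char_poly A.
Proof.
move=> uP; pose Q := map_mx polyC P; pose Q' := map_mx polyC (invmx P).
have QQ : Q' *m Q = 1%:M by rewrite -map_mxM mulVmx // map_mx1.
rewrite /char_poly.
have -> : char_poly_mx (invmx P *m A *m P) = Q' *m char_poly_mx A *m Q.
  rewrite /char_poly_mx !map_mxM mulmxBr mulmxBl; congr (_ - _).
  by rewrite scalar_mxC -mulmxA QQ mulmx1.
by rewrite !det_mulmx mulrAC -det_mulmx QQ det1 mul1r.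
Qed.

Lemma char_poly_diag (F : fieldType) (n : nat) (s : 'rV[F]_n) :
  char_poly (diag_mx s) = \prod_i ('X - (s 0 i)%:P).
Proof.
rewrite char_poly_trig ?diag_mx_is_trig //.
by apply: eq_bigr => i _; rewrite mxE eqxx mulr1n.
Qed.

Lemma det_similar (F : comUnitRingType) (n : nat) (P A : 'M[F]_n) : P \in unitmx ->
  \det (invmx P *m A *m P) = \det A.
Proof. by move=> uP; rewrite !det_mulmx mulrAC -det_mulmx mulVmx // det1 mul1r. Qed.

Section SigmaDeterminants.
Context {R : realType}.
Local Notation C := R[i].

Lemma det_gram (n : nat) (T : 'M[C]_n) :
  \det (T ^t* *m T) = (\prod_(i < n) sigma i.+1 T ^+ 2)%:C%C.
Proof.
have [P uP ->] := gram_similar_diag T.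
rewrite det_similar // det_diag rmorph_prod /=.
by apply: eq_bigr => i _; rewrite mxE.
Qed.

Lemma det_1gram (n : nat) (T : 'M[C]_n) :
  \det (1%:M + T ^t* *m T) = (\prod_(i < n) (1 + sigma i.+1 T ^+ 2))%:C%C.
Proof.
have [P uP ->] := gram_similar_diag T.
have -> (A : 'M[C]_n) : 1%:M + invmx P *m A *m P = invmx P *m (1%:M + A) *m P.
  by rewrite mulmxDr mulmx1 mulmxDl mulVmx.
rewrite det_similar // -diag_const_mx -raddfD /= det_diag rmorph_prod /=.
by apply: eq_bigr => i _; rewrite !mxE rmorphD.
Qed.

Lemma prod_sigma (n : nat) (T : 'M[C]_n) :
  \prod_(i < n) sigma i.+1 T = normc (\det T).
Proof.
apply/eqP; rewrite -(@eqrXn2 _ 2) ?prodr_ge0 ?normc_ge0 //; last first.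
  by move=> i _; exact: sigma_ge0.
apply/eqP/complexI; rewrite -prodrXl -det_gram det_mulmx normc_sqr.
by rewrite det_map_mx det_tr.
Qed.

Lemma sigma_gt0 (n i : nat) (T : 'M[C]_n) : (i < n)%N -> T \in unitmx ->
  0 < sigma i.+1 T.
Proof.
move=> lin uT; rewrite lt0r sigma_ge0 andbT.
have : normc (\det T) != 0 by rewrite normc_eq0 -unitfE -unitmxE.
by rewrite -prod_sigma => /prodf_neq0 /(_ (Ordinal lin) isT).
Qed.

End SigmaDeterminants.

(** * Inversion symmetry of the singular values *)

Section IndefiniteUnitarySigma.
Context {R : realType} {c d : nat}.
Local Notation C := R[i].
Local Notation G := (@Gform R c d).
Local Notation m := (c + d)%N.
Variable T : 'M[C]_m.
Hypothesis hT : Ugroup c d T.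

Let sg (i : nat) : R := sigma i.+1 T.

Lemma sg_gt0 i : (i < m)%N -> 0 < sg i.
Proof. by move=> im; apply: sigma_gt0 => //; exact: Ugroup_unit. Qed.

Lemma Ugroup_gram_inv : invmx (T ^t* *m T) = G *m (T ^t* *m T) *m G.
Proof.
have uH : T ^t* *m T \in unitmx.
  rewrite unitmx_mul (Ugroup_unit hT) andbT (Ugroup_tC hT).
  by rewrite !unitmx_mul Gform_unit unitmx_inv (Ugroup_unit hT).
apply: (can_inj (mulmxK uH)); rewrite mulVmx //.
have -> : G *m (T ^t* *m T) *m G *m (T ^t* *m T) =
    G *m (T ^t* *m (T *m G *m T ^t* ) *m T) by rewrite !mulmxA.
by rewrite Ugroup_tC_mul // hT GformK.
Qed.

(* [H = T^* T] satisfies [H^-1 = G H G], so its spectrum is invariant under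
   inversion. *)
Lemma sigma_sym i : (i < m)%N -> sigma (m - i.+1).+1 T = (sigma i.+1 T)^-1.
Proof.
move=> im.
pose s := singular_values T.
have szs : size s = m by exact: size_singular_values.
have sE k : nth 0 s k = sg k by [].
have s_gt0 x : x \in s -> 0 < x.
  by move=> /(nthP 0)[k]; rewrite szs => km <-; exact: sg_gt0.
have srt : sorted >=%R s by apply: sort_sorted => x y; exact: le_total.
(* Inverting reverses the order, so both lists are sorted the same way; it remains to see that each
   is a permutation of the other. *)
suff e : s = rev [seq x^-1 | x <- s].
  rewrite -[LHS]/(nth 0 s _) e nth_rev ?size_map ?szs ?ltn_subrL ?(leq_ltn_trans _ im) //.
  by rewrite (nth_map 0) ?szs; [congr (_^-1); rewrite -[RHS]/(nth 0 s i); congr nth; lia|lia].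
apply: (sorted_eq (@ge_trans _ R)) => //.
- by move=> x y; rewrite andbC; exact: le_anti.
- rewrite rev_sorted sorted_map.
  apply: (@sub_in_sorted _ (mem s) (>=%R)) srt; last exact/allP.
  by move=> x y xs ys /=; rewrite lef_pV2 ?posrE ?s_gt0.
(* The squares are the roots of the characteristic polynomials of the Gram matrix and of its
   inverse, which are conjugate under [G]. *)
have pm : perm_eq [seq (x ^+ 2)%:C%C | x <- s] [seq ((x^-1) ^+ 2)%:C%C | x <- s].
  apply: prod_XsubC_eq.
  have pE (g : R -> C) : \prod_(x <- [seq g x | x <- s]) ('X - x%:P) =
      \prod_(i < m) ('X - ((\row_(k < m) g (sg k)) 0 i)%:P).
    rewrite big_map (big_nth 0) szs big_mkord; apply: eq_bigr => k _.
    by rewrite mxE.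
  rewrite !pE.
  have [P uP HE] := gram_similar_diag T.
  pose u : 'rV[C]_m := \row_k (sg k ^+ 2)%:C%C.
  pose v : 'rV[C]_m := \row_k ((sg k)^-1 ^+ 2)%:C%C.
  rewrite -[\row_k (sg k ^+ 2)%:C%C]/u -[\row_k _]/v.
  rewrite -[\row_i _]/u in HE.
  have HiE : invmx (T ^t* *m T) = invmx P *m diag_mx v *m P.
    have uv : diag_mx u *m diag_mx v = 1%:M.
      rewrite mulmx_diag -diag_const_mx; congr diag_mx; apply/rowP => k.
      rewrite !mxE -rmorphM -exprMn. rewrite divff ?expr1n //; exact/lt0r_neq0/sg_gt0.
    have uvP : (T ^t* *m T) *m (invmx P *m diag_mx v *m P) = 1%:M.
      by rewrite HE -!mulmxA mulKVmx // (mulmxA (diag_mx u)) uv mul1mx mulVmx.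
    have [uH _] := mulmx1_unit uvP.
    by apply: (can_inj (mulKmx uH)); rewrite uvP mulmxV.
  rewrite -!char_poly_diag -(char_poly_similar (diag_mx u) uP) -HE.
  rewrite -(char_poly_similar (diag_mx v) uP) -HiE Ugroup_gram_inv.
  have Gi : invmx G = G.
    by apply: (can_inj (mulKmx (@Gform_unit R c d))); rewrite mulmxV ?Gform_unit ?GformK.
  by rewrite -{1}Gi char_poly_similar ?Gform_unit.
rewrite perm_sym perm_rev perm_sym.
have pm' := perm_map (fun z : C => Num.sqrt (complex.Re z)) pm.
rewrite -!map_comp in pm'.
have e1 : map ((fun z : C => Num.sqrt (complex.Re z)) \o (fun x => (x ^+ 2)%:C%C)) s = s.
  rewrite -[RHS]map_id; apply/eq_in_map => x /s_gt0 x0 /=.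
  by rewrite sqrtr_sqr gtr0_norm.
have e2 : map ((fun z : C => Num.sqrt (complex.Re z)) \o
    (fun x => (x^-1 ^+ 2)%:C%C)) s = map (fun x => x^-1) s.
  by apply/eq_in_map => x /s_gt0 x0 /=; rewrite sqrtr_sqr gtr0_norm // invr_gt0.
by move: pm'; rewrite e1 e2.
Qed.

End IndefiniteUnitarySigma.

(** * The middle singular values and the formula for [Nfun] *)

Section IndefiniteUnitarySpectrum.
Context {R : realType} {c d : nat}.
Local Notation C := R[i].
Local Notation G := (@Gform R c d).
Local Notation m := (c + d)%N.
Variable T : 'M[C]_m.
Hypothesis hT : Ugroup c d T.

(* [1 + G] and [1 - G] have ranks [c] and [d], and
   [T^* T - 1 = T^* (1 + e G) T - (1 + e G)] for [e = 1, -1]. *)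
Lemma Ugroup_rank_gram : (\rank (T ^t* *m T - 1%:M)%R <= 2 * minn c d)%N.
Proof.
have key (E : 'M[C]_m) k : (\rank E <= k)%N ->
    T ^t* *m E *m T - E = T ^t* *m T - 1%:M ->
    (\rank (T ^t* *m T - 1%:M)%R <= 2 * k)%N.
  move=> Ek <-; rewrite (leq_trans (mxrank_add _ _)) // mxrank_opp mul2n -addnn.
  rewrite leq_add // (leq_trans (mxrankM_maxl _ _)) //.
  by rewrite (leq_trans (mxrankM_maxr _ _)).
have e1 : T ^t* *m (1%:M + G) *m T - (1%:M + G) = T ^t* *m T - 1%:M.
  rewrite mulmxDr mulmx1 mulmxDl hT opprD addrACA subrr addr0 //.
have e2 : T ^t* *m (1%:M - G) *m T - (1%:M - G) = T ^t* *m T - 1%:M.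
  by rewrite mulmxBr mulmx1 mulmxBl hT opprB addrA subrK.
rewrite /minn; case: ltnP => _; [apply: key e1 | apply: key e2].
  have -> : 1%:M + G = col_mx 1%:M 0 *m row_mx 2%:M 0.
    rewrite mul_col_row mul1mx mulmx0 !mul0mx /Gform scalar_mx_block.
    by rewrite add_block_mx subrr !addr0 -raddfD.
  exact: mulmx_max_rank.
have -> : 1%:M - G = col_mx 0 1%:M *m row_mx 0 2%:M.
  rewrite mul_col_row mul1mx mulmx0 !mul0mx /Gform scalar_mx_block.
  by rewrite mul1mx opp_block_mx add_block_mx subrr !oppr0 opprK !addr0 -raddfD.
exact: mulmx_max_rank.
Qed.

(** A value above 1 at an index at least [minn c d] would, by monotonicity and the inversion
    symmetry, put more than [2 * minn c d] singular values away from 1, against the rank bound. A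
    value below 1 is excluded through its mirror index. *)
Lemma sigma_mid i : (minn c d <= i < m - minn c d)%N -> sigma i.+1 T = 1.
Proof.
have main k : (minn c d <= k < m - minn c d)%N -> ~ 1 < sigma k.+1 T.
  move=> /andP[k1 k2] sk.
  have km : (k < m)%N by lia.
  have skp := sigma_gt0 km (Ugroup_unit hT).
  (* A value above 1 precedes its inverse, so the first and the last [k.+1] indices do not
     overlap. *)
  have ksym : (k < m - k.+1)%N.
    rewrite ltnNge; apply/negP => kk.
    have : sigma k.+1 T <= sigma (m - k.+1).+1 T by apply: sigma_noninc; lia.
    rewrite (sigma_sym hT) // leNgt => /negP; apply.
    by rewrite (lt_trans _ sk) // invf_lt1.
  pose n := (k.+1 + k.+1)%N.
  (* Enumerates the first [k.+1] indices, then the last [k.+1]. *)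
  pose g (x : nat) := if (x < k.+1)%N then x else (m - n + x)%N.
  have gm (x : 'I_n) : (g x < m)%N.
    by rewrite /g; have := ltn_ord x; rewrite /n; case: ifP; lia.
  pose f (x : 'I_n) := Ordinal (gm x).
  have finj : injective f.
    move=> x y /(congr1 val) /= gxy; apply/val_inj => /=; move: gxy.
    by rewrite /g; have := ltn_ord x; have := ltn_ord y; rewrite /n; do 2 case: ifP; lia.
  pose u : 'rV[C]_m := \row_i ((sigma i.+1 T) ^+ 2 - 1)%:C%C.
  have : (#|(f @: [set: 'I_n])%SET| <= \rank (diag_mx u)%R)%N.
    apply: rank_diag_ge => a /imsetP[x _ ->]; rewrite mxE /=.
    rewrite -[X in _ != X]/(0%:C%C) (inj_eq (@complexI R)) subr_eq0 sqrp_eq1 ?sigma_ge0 //.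
    rewrite /g; case: ifPn => xk.
      by rewrite gt_eqF // (lt_le_trans sk) // sigma_noninc //; lia.
    rewrite lt_eqF //.
    apply: (@le_lt_trans _ _ (sigma (m - k.+1).+1 T)).
      by apply: sigma_noninc; have := ltn_ord x; rewrite /n in xk *; lia.
    by rewrite (sigma_sym hT) // invf_lt1.
  rewrite card_imset // cardsT card_ord.
  have -> : \rank (diag_mx u)%R = \rank (T ^t* *m T - 1%:M)%R.
    have [P uP ->] := gram_similar_diag T.
    have -> (E : 'M[C]_m) : invmx P *m E *m P - 1%:M = invmx P *m (E - 1%:M) *m P.
      by rewrite mulmxBr mulmx1 mulmxBl mulVmx.
    rewrite mxrankMfree ?row_free_unit // eqmxMfull ?row_full_unit ?unitmx_inv //.
    rewrite -diag_const_mx -raddfB /=; congr (\rank (diag_mx _)).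
    by apply/rowP => a; rewrite !mxE rmorphB.
  by move=> /leq_trans /(_ Ugroup_rank_gram); rewrite /n; lia.
move=> ik; have im : (i < m)%N by lia.
have := main i ik; have := main (m - i.+1)%N.
rewrite (sigma_sym hT) // => h1 h2.
have sp := sigma_gt0 im (Ugroup_unit hT).
apply/eqP; rewrite eq_le; apply/andP; split; rewrite leNgt; apply/negP => //.
by move=> s1; apply: h1; [lia|rewrite invf_gt1].
Qed.

(** Below [minn c d] the mirror index comes no earlier, so the value dominates its own inverse; from
    there up to [d] the value is 1. *)
Lemma sigma_ge1 i : (i < d)%N -> 1 <= sigma i.+1 T.
Proof.
move=> id; have [ic|ci] := ltnP i (minn c d); last by rewrite sigma_mid //; lia.
have im : (i < m)%N by lia.
have sp := sigma_gt0 im (Ugroup_unit hT).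
have : sigma (m - i.+1).+1 T <= sigma i.+1 T by apply: sigma_noninc; lia.
rewrite (sigma_sym hT) // => h.
rewrite leNgt; apply/negP => s1; have : 1 < (sigma i.+1 T)^-1 by rewrite invf_gt1.
by move=> h2; have := lt_trans s1 (lt_le_trans h2 h); rewrite ltxx.
Qed.

Let g (i : nat) : R := (sigma i.+1 T + (sigma i.+1 T)^-1) / 2.

(** The product over all [m] indices is the square of the right-hand side, by the determinant of
    [1%:M + T ^t* *m T]. The symmetry identifies its last [c] factors with its first [c], and the
    products of the first [c] and of the first [d] factors agree since they differ by middle factors
    equal to 1. *)
Lemma prod_cosh_sigma : \prod_(0 <= i < d) g i = normc (\det (drsubmx T)).
Proof.
have gsym i : (i < m)%N -> g (m - i.+1) = g i.
  by move=> im; rewrite /g (sigma_sym hT) // invrK addrC.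
have all : \prod_(0 <= i < m) g i = normc (\det (drsubmx T)) ^+ 2.
  have := Ugroup_det_1gram hT; rewrite det_1gram.
  have -> : normc (\prod_(i < m) (1 + sigma i.+1 T ^+ 2))%:C%C =
      \prod_(i < m) (1 + sigma i.+1 T ^+ 2).
    apply: complexI; rewrite normc_normr ger0_norm // ler0c.
    by apply: prodr_ge0 => i _; rewrite addr_ge0 ?exprn_ge0 ?sigma_ge0.
  move=> e; apply: (mulfI (_ : 2 ^+ m != 0 :> R)); first by rewrite expf_neq0.
  have prod1 : \prod_(i < m) sigma i.+1 T = 1 by rewrite prod_sigma Ugroup_det.
  rewrite -e -[LHS]mulr1 -[X in _ * X = _]prod1 big_mkord mulrAC.
  rewrite -[X in 2 ^+ X](card_ord m) -prodr_const -!big_split /=.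
  apply: eq_bigr => i _; have /gt_eqF/negbT s0 := sg_gt0 hT (ltn_ord i).
  by rewrite /g; field.
have tail : \prod_(d <= i < m) g i = \prod_(0 <= i < c) g i.
  rewrite -{1}[d]add0n big_addn addnK big_nat_rev add0n.
  by apply: eq_big_nat => i /andP[_ ic]; rewrite -gsym; [congr g; lia|lia].
have g1 i : (minn c d <= i < m - minn c d)%N -> g i = 1.
  by move=> ?; rewrite /g sigma_mid // invr1 divff.
have trunc k : (minn c d <= k <= m - minn c d)%N ->
    \prod_(0 <= i < k) g i = \prod_(0 <= i < minn c d) g i.
  move=> /andP[k1 k2]; rewrite (big_cat_nat (n := minn c d)) //=.
  by rewrite [X in _ * X]big_nat [X in _ * X]big1 ?mulr1 // => i ?; apply: g1; lia.
have mid : \prod_(0 <= i < c) g i = \prod_(0 <= i < d) g i.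
  by rewrite !trunc //; lia.
apply/eqP; rewrite -(@eqrXn2 _ 2) ?normc_ge0 //; last first.
  apply: prodr_ge0 => i _.
  by rewrite divr_ge0 ?addr_ge0 ?invr_ge0 ?sigma_ge0.
by apply/eqP; rewrite -all [RHS](big_cat_nat (n := d)) ?leq_addl //= tail mid expr2.
Qed.

Lemma Nfun_det : Nfun d T = ln (normc (\det (drsubmx T))).
Proof.
rewrite -prod_cosh_sigma /Nfun big_add1 /=.
have g0 i : (i < m)%N -> 0 < g i.
  by move=> im; have sp := sg_gt0 hT im; rewrite divr_gt0 ?addr_gt0 ?invr_gt0.
suff H k : (k <= m)%N ->
    \sum_(0 <= i < k) ln (g i) = ln (\prod_(0 <= i < k) g i).
  by apply: H; rewrite leq_addl.
elim: k => [|k IH] km; first by rewrite !big_geq // ln1.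
rewrite !big_nat_recr //= IH ?(ltnW km) // lnM ?posrE ?g0 //.
by rewrite big_nat prodr_gt0 // => i ik; apply: g0; lia.
Qed.

(** For [s >= 1], the mean of [s] and its inverse lies between [s / 2] and [s]. *)
Lemma Nfun_bounds :
  \sum_(i < d) ln (sigma i.+1 T) - d%:R * ln 2 <= Nfun d T <=
  \sum_(i < d) ln (sigma i.+1 T).
Proof.
rewrite /Nfun big_add1 /= big_mkord mulr_natl.
rewrite -[X in _ *+ X](card_ord d) -sumr_const -sumrB.
have s1 (i : 'I_d) := sigma_ge1 (ltn_ord i).
have sp (i : 'I_d) : 0 < sigma i.+1 T := lt_le_trans ltr01 (s1 i).
apply/andP; split; apply: ler_sum => i _.
  rewrite -ln_div ?posrE // ler_ln ?posrE ?divr_gt0 ?addr_gt0 ?invr_gt0 //.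
  by rewrite ler_pM2r ?invr_gt0 // lerDl invr_ge0 ltW.
rewrite ler_ln ?posrE ?divr_gt0 ?addr_gt0 ?invr_gt0 //.
rewrite ler_pdivrMr // mulr_natr mulr2n lerD2l (le_trans _ (s1 i)) //.
by rewrite invf_le1.
Qed.

End IndefiniteUnitarySpectrum.

(** * Measurability of complex functions, matrices and singular values *)

Section ComplexMeasurability.
Context {R : realType} {disp : measure_display} {X : measurableType disp}.
Local Notation C := R[i].

(** The condition that [measurable_mx] puts on each entry, isolated so that it can be propagated
    through sums and products. *)
Definition measurable_C (h : X -> C) : Prop :=
  measurable_fun [set: X] (fun x => complex.Re (h x)) /\
  measurable_fun [set: X] (fun x => complex.Im (h x)).

Lemma measurable_C_cst (z : C) : measurable_C (fun=> z).
Proof. by split; exact: measurable_cst. Qed.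

Lemma measurable_CD (g h : X -> C) :
  measurable_C g -> measurable_C h -> measurable_C (fun x => g x + h x).
Proof.
move=> [g1 g2] [h1 h2]; split.
  rewrite (_ : (fun x => _) =
    (fun x => complex.Re (g x)) \+ (fun x => complex.Re (h x))); last first.
    by apply/funext => x /=; rewrite raddfD.
  exact: measurable_funD.
rewrite (_ : (fun x => _) =
    (fun x => complex.Im (g x)) \+ (fun x => complex.Im (h x))); last first.
  by apply/funext => x /=; rewrite raddfD.
exact: measurable_funD.
Qed.

Lemma measurable_CM (g h : X -> C) :
  measurable_C g -> measurable_C h -> measurable_C (fun x => g x * h x).
Proof.
move=> [g1 g2] [h1 h2]; split.
  rewrite (_ : (fun x => _) =
    ((fun x => complex.Re (g x)) \* (fun x => complex.Re (h x))) \-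
    ((fun x => complex.Im (g x)) \* (fun x => complex.Im (h x)))); last first.
    by apply/funext => x /=; case: (g x) (h x) => [? ?] [? ?].
  by apply: measurable_funB; apply: measurable_funM.
rewrite (_ : (fun x => _) =
    ((fun x => complex.Re (g x)) \* (fun x => complex.Im (h x))) \+
    ((fun x => complex.Im (g x)) \* (fun x => complex.Re (h x)))); last first.
  by apply/funext => x /=; case: (g x) (h x) => [? ?] [? ?].
by apply: measurable_funD; apply: measurable_funM.
Qed.

Lemma measurable_C_sum (I : Type) (r : seq I) (P : pred I) (F : I -> X -> C) :
  (forall i, measurable_C (F i)) ->
  measurable_C (fun x => \sum_(i <- r | P i) F i x).
Proof.
move=> mF; elim: r => [|i r IH].
  by under eq_fun do rewrite big_nil; exact: measurable_C_cst.
under eq_fun do rewrite big_cons.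
by case: (P i) => //; exact: measurable_CD.
Qed.

Lemma measurable_C_prod (I : Type) (r : seq I) (P : pred I) (F : I -> X -> C) :
  (forall i, measurable_C (F i)) ->
  measurable_C (fun x => \prod_(i <- r | P i) F i x).
Proof.
move=> mF; elim: r => [|i r IH].
  by under eq_fun do rewrite big_nil; exact: measurable_C_cst.
under eq_fun do rewrite big_cons.
by case: (P i) => //; exact: measurable_CM.
Qed.

Lemma measurable_normc (h : X -> C) :
  measurable_C h -> measurable_fun [set: X] (fun x => normc (h x)).
Proof.
move=> [h1 h2].
rewrite (_ : (fun x => _) = (@Num.sqrt R) \o
   ((fun x => complex.Re (h x) ^+ 2) \+ (fun x => complex.Im (h x) ^+ 2))); last first.
  by apply/funext => x /=; case: (h x).
apply: measurableT_comp.
  by apply: continuous_measurable_fun => x; exact: sqrt_continuous.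
by apply: measurable_funD; apply: measurable_funX.
Qed.

Lemma measurable_C_det (k : nat) (M : X -> 'M[C]_k) :
  (forall i j, measurable_C (fun x => M x i j)) ->
  measurable_C (fun x => \det (M x)).
Proof.
move=> mM; apply: measurable_C_sum => s; apply: measurable_CM.
  exact: measurable_C_cst.
by apply: measurable_C_prod => i; exact: mM.
Qed.

Section Matrices.
Variable m : nat.
Implicit Types A B : X -> 'M[C]_m.

Lemma measurable_mx_mul A B : measurable_mx A -> measurable_mx B ->
  measurable_mx (fun x => A x *m B x).
Proof.
move=> mA mB i j; under eq_fun do rewrite mxE.
under [X in _ /\ measurable_fun _ X]eq_fun do rewrite mxE.
by apply: measurable_C_sum => k; exact: measurable_CM.
Qed.

Lemma measurable_mx_cst (M : 'M[C]_m) : measurable_mx (fun _ : X => M).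
Proof. by move=> i j; exact: measurable_C_cst. Qed.

Lemma measurable_mx_tC A : measurable_mx A -> measurable_mx (fun x => A x ^t* ).
Proof.
move=> mA i j; have [h1 h2] := mA j i; split.
  rewrite (_ : (fun x => _) = (fun x => complex.Re (A x j i))) //.
  by apply/funext => x; rewrite !mxE; case: (A x j i).
rewrite (_ : (fun x => _) = \- (fun x => complex.Im (A x j i))).
  exact: measurable_funN.
by apply/funext => x; rewrite !mxE /=; case: (A x j i).
Qed.

Lemma measurable_mx_exp A p : measurable_mx A -> measurable_mx (fun x => A x ^+ p).
Proof.
move=> mA; elim: p => [|p IH].
  by under eq_fun do rewrite expr0; exact: measurable_mx_cst.
by under eq_fun do rewrite exprS; exact: measurable_mx_mul.
Qed.

Lemma measurable_mx_comp f A : measurable_fun [set: X] f -> measurable_mx A ->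
  measurable_mx (A \o f).
Proof.
move=> mf mA i j; have [h1 h2] := mA i j; split.
  exact: (measurableT_comp h1 mf).
exact: (measurableT_comp h2 mf).
Qed.

Lemma measurable_mx_cocycle f A n : measurable_fun [set: X] f ->
  measurable_mx A -> measurable_mx (cocycle f A n).
Proof.
move=> mf mA; elim: n => [|n IH] /=; first exact: measurable_mx_cst.
apply: measurable_mx_mul => //; apply: (measurable_mx_comp (f := iter n f)) => //.
by elim: n {IH} => [|n IH] /=; [exact: measurable_id|exact: measurableT_comp].
Qed.

Lemma measurable_minorsum j A : measurable_mx A ->
  measurable_fun [set: X] (fun x => minorsum j (A x)).
Proof.
move=> mA; apply: measurable_sum => f; apply: measurable_sum => g.
apply: measurable_normc; apply: measurable_C_det => a b.
by under eq_fun do rewrite mxE; exact: mA.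
Qed.

(** Sorted eigenvalues are not explicit functions of the entries, but the traces [extr] of powers of
    the Gram matrix are polynomial in the entries and their conjugates, and their normalized
    logarithms converge to the function. *)
Lemma measurable_ln_sigma_prod j A : (j <= m)%N -> (forall x, A x \in unitmx) ->
  measurable_mx A -> measurable_fun [set: X] (fun x => ln (sigma_prod j (A x))).
Proof.
move=> jm uA mA.
pose E p x := complex.Re (extr j ((A x ^t* *m A x) ^+ p)).
have mE p : measurable_fun [set: X] (E p).
  suff [] : measurable_C (fun x => extr j ((A x ^t* *m A x) ^+ p)) by [].
  apply: measurable_C_sum => g; apply: measurable_C_det => a b.
  under eq_fun do rewrite mxE.
  apply: (measurable_mx_exp p (A := fun x => A x ^t* *m A x)).
  by apply: measurable_mx_mul => //; exact: measurable_mx_tC.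
apply: (measurable_fun_cvg (h := fun p x => (2 * p.+1)%:R^-1 * ln (E p.+1 x))).
  move=> p; apply: measurable_funM => //.
  by apply: measurableT_comp => //; exact: measurable_ln.
move=> x _.
have tp : 0 < sigma_prod j (A x).
  by apply: prodr_gt0 => i _; apply: sigma_gt0 => //; exact: leq_trans jm.
have mj0 : 0 < (m ^ j)%:R :> R.
  by rewrite ltr0n expn_gt0; case: (j) jm => [|k]; [rewrite orbT|case: (m)].
(* The trace lies between the power of [sigma_prod] and [m ^ j] times it, so the error vanishes
   after division by the exponent. *)
apply: (@squeeze_cvgr _ _ _ _ (fun=> ln (sigma_prod j (A x)))
   (fun p => ln (sigma_prod j (A x)) + ln (m ^ j)%:R * p.+1%:R^-1)).
- near=> p.
  have p0 : 0 < (2 * p.+1)%:R :> R by rewrite ltr0n.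
  have Ege := extr_gram_ge p.+1 (A x) jm.
  have E0 : 0 < E p.+1 x by apply: lt_le_trans Ege; rewrite exprn_gt0.
  have lnX : ln (sigma_prod j (A x) ^+ (2 * p.+1)) = (2 * p.+1)%:R * ln (sigma_prod j (A x)).
    by rewrite lnXn // mulr_natl.
  rewrite ![_^-1 * ln _]mulrC ler_pdivlMr // ler_pdivrMr // ![ln (sigma_prod _ _) * _]mulrC -lnX.
  rewrite ler_ln ?posrE ?exprn_gt0 // Ege /=.
  apply: (@le_trans _ _ (ln ((m ^ j)%:R * (sigma_prod j (A x)) ^+ (2 * p.+1)))).
    by rewrite ler_ln ?posrE ?mulr_gt0 ?exprn_gt0 //; exact: extr_gram_le.
  rewrite lnM ?posrE ?exprn_gt0 // lnX mulrDl addrC [ln (sigma_prod _ _) * _]mulrC lerD2l.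
  rewrite natrM [2 * _]mulrC mulrA mulfVK ?pnatr_eq0 // ler_peMr ?ler1n //.
  by rewrite ln_ge0 // ler1n -(ltr0n R).
- exact: cvg_cst.
- rewrite -[X in _ --> X]addr0 -[X in _ + X](mulr0 (ln (m ^ j)%:R)).
  apply: cvgD; first exact: cvg_cst.
  by apply: cvgM; [exact: cvg_cst|exact: cvg_harmonic].
Unshelve. all: by end_near. Qed.

End Matrices.
End ComplexMeasurability.

(** * Fekete's lemma for nonnegative subadditive sequences *)

Lemma subadditive_cvg (R : realType) (u : nat -> R) :
  (forall n, 0 <= u n) -> (forall n k, u (n + k)%N <= u n + u k) ->
  exists L : R, (fun n => n%:R^-1 * u n) @ \oo --> L.
Proof.
(* The limit is the infimum of the normalized terms; the shift to [n.+1] leaves out the meaningless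
   quotient at 0. *)
move=> u0 uD; pose E := [set n.+1%:R^-1 * u n.+1 | n in [set: nat]].
have E0 : E !=set0 by exists (1%:R^-1 * u 1%N); exists 0%N.
have lbE : lbound E 0 by move=> _ [n _ <-]; rewrite mulr_ge0 ?invr_ge0.
have hE : has_inf E by split => //; exists 0.
exists (inf E); apply/cvgrPdist_le => /= e e0.
have e20 : 0 < e / 2 by rewrite divr_gt0.
have [_ [N _ <-] uN] := inf_adherent e20 hE.
(* Bounds [u] at every remainder of the division by [N.+1]. *)
pose M := \sum_(r < N.+1) u r.
have uq q r : u (q * N.+1 + r)%N <= q%:R * u N.+1 + u r.
  elim: q => [|q IH]; first by rewrite mul0n mul0r !add0r.
  rewrite mulSn -addnA (le_trans (uD _ _)) // -natr1 mulrDl mul1r addrAC [leRHS]addrC.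
  by rewrite lerD2l.
near=> n.
have n0 : (0 < n)%N by near: n; exists 1%N.
have n0R : 0 < n%:R :> R by rewrite ltr0n.
have lb : inf E <= n%:R^-1 * u n.
  by apply: ge_inf; [exists 0|exists n.-1; rewrite ?prednK].
rewrite distrC ger0_norm ?subr_ge0 // lerBlDl.
have ur : u (n %% N.+1)%N <= M.
  have rN : (n %% N.+1 < N.+1)%N by rewrite ltn_mod.
  by rewrite /M (bigD1 (Ordinal rN)) //= lerDl sumr_ge0.
have h : u n <= n%:R * (N.+1%:R^-1 * u N.+1) + M.
  rewrite {1}(divn_eq n N.+1) (le_trans (uq _ _)) // lerD // mulrA ler_wpM2r //.
  by rewrite ler_pdivlMr ?ltr0n // -natrM ler_nat leq_trunc_div.
have M0 : 0 <= M by apply: sumr_ge0.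
have Mn : n%:R^-1 * M <= e / 2.
  rewrite ler_pdivrMl // -ler_pdivrMr //.
  by near: n; exact: nbhs_infty_ger.
rewrite ler_pdivrMl // (le_trans h) // [e]splitr addrA mulrDr lerD //.
  by rewrite ler_wpM2l // ltW.
by rewrite -ler_pdivrMl.
Unshelve. all: by end_near. Qed.

(** Starts at [n.+1] because subadditivity allows [v 0] to be positive. *)
Lemma subadditive_le (R : realType) (v : nat -> R) n :
  (forall n k, v (n + k)%N <= v n + v k) -> v n.+1 <= n.+1%:R * v 1%N.
Proof.
move=> vD; elim: n => [|n IH]; first by rewrite mul1r.
by rewrite -addn1 natrD mulrDl mul1r (le_trans (vD _ _)) // lerD2r.
Qed.

(** * Integrability of real functions and measure-preserving maps *)

Section RealIntegrable.
Context {R : realType} {disp : measure_display} {X : measurableType disp}.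
Variables (mu : {measure set X -> \bar R}) (D : set X) (mD : measurable D).
Implicit Types g h : X -> R.
Local Notation intg g := (mu.-integrable D (EFin \o g)).

Lemma integrableD_EFin g h : intg g -> intg h -> intg (fun x => g x + h x).
Proof. by move=> ig ih; have := integrableD mD ig ih. Qed.

Lemma integrableB_EFin g h : intg g -> intg h -> intg (fun x => g x - h x).
Proof. by move=> ig ih; have := integrableB mD ig ih. Qed.

Lemma integrableZl_EFin (r : R) g : intg g -> intg (fun x => r * g x).
Proof. by move=> ig; have := integrableZl mD r ig. Qed.

Lemma le_integrable_EFin g h : measurable_fun D g ->
  (forall x, D x -> `|g x| <= h x) -> intg h -> intg g.
Proof.
move=> mg gh ih; apply: le_integrable ih => //; first exact/measurable_EFinP.
by move=> x Dx; rewrite /= lee_fin (le_trans (gh x Dx)) // ler_norm.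
Qed.

End RealIntegrable.

Section MeasurePreserving.
Context {R : realType} {disp : measure_display} {X : measurableType disp}.
Variables (mu : {measure set X -> \bar R}) (f : X -> X).
Hypothesis hf : measure_preserving mu f.
Local Notation intg g := (mu.-integrable [set: X] (EFin \o g)).

(** Invariance of the integral applied to the modulus of [g] gives the finiteness required after
    composition. *)
Lemma integrable_mp (g : X -> R) : intg g -> intg (g \o f).
Proof.
move=> ig; have /integrableP[mg lg] := ig.
have mg' : measurable_fun [set: X] g by exact/measurable_EFinP.
apply/integrableP; split.
  by apply/measurable_EFinP; exact: (measurableT_comp mg' hf.1).
have iag : intg (fun x => `|g x|) by exact: (integrable_abse ig).
by have := hf.2 _ iag => /= ->.
Qed.

Lemma integrable_mp_iter (g : X -> R) n : intg g -> intg (g \o iter n f).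
Proof.
move=> ig; elim: n => [|n IH] //.
by have := integrable_mp IH; congr integrable; apply/funext => x /=; rewrite -iterSr.
Qed.

Lemma Rintegral_mp_iter (g : X -> R) n : intg g ->
  \int[mu]_x g (iter n f x) = \int[mu]_x g x.
Proof.
move=> ig; elim: n => [|n IH] //.
rewrite -[RHS]IH /Rintegral; congr fine.
rewrite -(hf.2 _ (integrable_mp_iter n ig)).
by apply: eq_integral => x _ /=; rewrite -iterSr.
Qed.

End MeasurePreserving.

(** * The indefinite unitary group along a cocycle *)

Section UgroupCocycle.
Context {R : realType} {c d : nat}.
Local Notation C := R[i].
Local Notation m := (c + d)%N.

Lemma Ugroup1 : Ugroup c d (1%:M : 'M[C]_m).
Proof. by rewrite /Ugroup /= trmx1 map_mx1 mul1mx mulmx1. Qed.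

Lemma UgroupM (S T : 'M[C]_m) : Ugroup c d S -> Ugroup c d T -> Ugroup c d (S *m T).
Proof.
rewrite /Ugroup /= => hS hT; rewrite trmx_mul map_mxM /= -!mulmxA.
by rewrite (mulmxA (Gform _ _)) (mulmxA (S ^t* )) (mulmxA (S ^t* )) hS mulmxA.
Qed.

Lemma Ugroup_cocycle (disp : measure_display) (Y : measurableType disp)
    (f : Y -> Y) (A : Y -> 'M[C]_m) n x :
  (forall x, Ugroup c d (A x)) -> Ugroup c d (cocycle f A n x).
Proof. by move=> hA; elim: n => [|n IH] /=; [exact: Ugroup1|exact: UgroupM]. Qed.

Lemma ln_sigma_prod (j : nat) (T : 'M[C]_m) : (j <= m)%N -> T \in unitmx ->
  ln (sigma_prod j T) = \sum_(i < j) ln (sigma i.+1 T).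
Proof.
move=> + uT; elim: j => [|j IH] jm; first by rewrite /sigma_prod !big_ord0 ln1.
rewrite /sigma_prod !big_ord_recr /= lnM ?posrE ?sigma_gt0 //.
  by rewrite -IH ?(ltnW jm).
by apply: prodr_gt0 => i _; apply: sigma_gt0 => //; rewrite (ltn_trans _ jm).
Qed.

Lemma sigma_prod0 (T : 'M[C]_m) : sigma_prod 0 T = 1.
Proof. by rewrite /sigma_prod big_ord0. Qed.

Lemma sigma_prod_ge1 (j : nat) (T : 'M[C]_m) : Ugroup c d T -> (j <= d)%N -> 1 <= sigma_prod j T.
Proof.
move=> hT jd; apply: (big_ind (fun z => 1 <= z)) => // [x y|i _].
  by move=> x1 y1; rewrite mulr_ege1.
by apply: sigma_ge1 => //; exact: leq_trans jd.
Qed.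

Lemma sigma_prod_le_minorsum1 (j : nat) (T : 'M[C]_m) : (0 < m)%N ->
  sigma_prod j T <= minorsum 1 T ^+ j.
Proof.
move=> m0; rewrite -[X in _ ^+ X](card_ord j) -prodr_const; apply: ler_prod => i _.
rewrite sigma_ge0 /=.
apply: (@le_trans _ _ (sigma_prod 1 T)); last exact: sigma_prod_le_minorsum.
rewrite /sigma_prod big_ord1; have [im|mi] := ltnP i m; first exact: sigma_noninc.
(* An index past the last singular value reads the default 0, so [j] need not be at most [m]. *)
rewrite {1}/sigma nth_default ?sigma_ge0 //.
by rewrite size_singular_values.
Qed.

End UgroupCocycle.

(** * Integrals of subadditive processes *)

Section SubadditiveProcess.
Context {R : realType} {disp : measure_display} {X : measurableType disp}.
Variables (mu : {measure set X -> \bar R}) (f : X -> X).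
Hypothesis hf : measure_preserving mu f.
Local Notation intg g := (mu.-integrable [set: X] (EFin \o g)).

Lemma integrable_process (g : X -> R) (phi : nat -> X -> R) :
  intg g -> intg (phi 0%N) -> (forall n, measurable_fun [set: X] (phi n)) ->
  (forall n x, 0 <= phi n x) ->
  (forall n x, phi n.+1 x <= g (iter n f x) + phi n x) ->
  forall n, intg (phi n).
Proof.
move=> ig i0 mphi phi0 phiS; elim=> [//|n IH].
apply: (le_integrable_EFin measurableT (mphi n.+1) (h := fun x => g (iter n f x) + phi n x)).
  by move=> x _; rewrite ger0_norm.
apply: integrableD_EFin => //; exact: (integrable_mp_iter hf n ig).
Qed.

Lemma Rintegral_process_subadditive (phi : nat -> X -> R) n k :
  (forall n, intg (phi n)) ->
  (forall x, phi (n + k)%N x <= phi n (iter k f x) + phi k x) ->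
  \int[mu]_x phi (n + k)%N x <= \int[mu]_x phi n x + \int[mu]_x phi k x.
Proof.
move=> iphi phiD; have i1 := integrable_mp_iter hf k (iphi n).
rewrite -(Rintegral_mp_iter hf k (iphi n)) -RintegralD //.
by apply: le_Rintegral => //; exact: integrableD_EFin.
Qed.

End SubadditiveProcess.

(** * Existence of the Lyapunov exponents *)

Section LyapunovExponents.
(* Unification must not unfold determinants and sorted spectra. *)
#[local] Opaque minorsum sigma_prod sigma.
Context {R : realType} {c d : nat} {disp : measure_display} {X : measurableType disp}.
Local Notation C := R[i].
Local Notation m := (c + d)%N.
Variables (mu : probability X R) (f : X -> X) (A : X -> 'M[C]_m).
Hypotheses (d0 : (0 < d)%N) (hf : measure_preserving mu f)
  (hA : forall x, Ugroup c d (A x)) (mA : measurable_mx A)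
  (iA : mu.-integrable [set: X] (fun x => (ln (minorsum 1 (A x)))%:E)).
Local Notation intg g := (mu.-integrable [set: X] (EFin \o g)).

Let m0 : (0 < m)%N. Proof. by rewrite addn_gt0 d0 orbT. Qed.
Let B n := cocycle f A n.
Let hB n x : Ugroup c d (B n x). Proof. exact: Ugroup_cocycle. Qed.
Let uB n x : B n x \in unitmx. Proof. exact: Ugroup_unit. Qed.
Let mB n : measurable_mx (B n).
Proof. by apply: measurable_mx_cocycle => //; exact: hf.1. Qed.

Let integrable_cst (r : R) : intg (fun _ : X => r).
Proof. exact: finite_measure_integrable_cst. Qed.

Lemma minorsum_ge1 j (T : 'M[C]_m) : (j <= d)%N -> Ugroup c d T -> 1 <= minorsum j T.
Proof.
move=> jd hT; apply: le_trans (sigma_prod_ge1 hT jd) _.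
by apply: sigma_prod_le_minorsum; rewrite (leq_trans jd) // leq_addl.
Qed.

Lemma ln_minorsum_ge0 j (T : 'M[C]_m) : (j <= d)%N -> Ugroup c d T ->
  0 <= ln (minorsum j T).
Proof. by move=> jd hT; rewrite ln_ge0 // minorsum_ge1. Qed.

Lemma ln_minorsumM j (S T : 'M[C]_m) : (j <= d)%N -> Ugroup c d S -> Ugroup c d T ->
  ln (minorsum j (S *m T)) <= ln (minorsum j S) + ln (minorsum j T).
Proof.
move=> jd hS hT.
have p (V : 'M[C]_m) : Ugroup c d V -> 0 < minorsum j V.
  by move=> hV; exact: lt_le_trans ltr01 (minorsum_ge1 jd hV).
rewrite -lnM ?posrE ?p // ler_ln ?posrE ?mulr_gt0 ?p //; last exact: UgroupM.
exact: minorsum_mulmx.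
Qed.

Lemma cocycleD n k x : B (n + k)%N x = B n (iter k f x) *m B k x.
Proof.
rewrite /B; elim: n => [|n IH] /=; first by rewrite mul1mx.
by rewrite IH mulmxA iterD.
Qed.

(** Up to a constant factor [minorsum j] is at most [sigma_prod j], which is at most the [j]-th
    power of [minorsum 1]; the logarithm is nonnegative, so an upper bound suffices. *)
Lemma integrable_ln_minorsum j : (j <= d)%N ->
  intg (fun x => ln (minorsum j (A x))).
Proof.
move=> jd; have [K K0 KP] := @minorsum_le_sigma_prod R m j.
have ig : intg (fun x => ln K + j%:R * ln (minorsum 1 (A x))).
  apply: integrableD_EFin; [exact: measurableT|exact: integrable_cst|].
  by apply: integrableZl_EFin; [exact: measurableT|exact: iA].
apply: (le_integrable_EFin measurableT _ _ ig).
  by apply: measurableT_comp; [exact: measurable_ln|exact: measurable_minorsum].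
move=> x _; have h0 := ln_minorsum_ge0 jd (hA x); rewrite (ger0_norm h0).
have s1 := minorsum_ge1 d0 (hA x).
have p1 : 0 < minorsum 1 (A x) by exact: lt_le_trans s1.
have pj : 0 < minorsum j (A x) by exact: lt_le_trans (minorsum_ge1 jd (hA x)).
rewrite mulr_natl -lnXn // -lnM ?posrE ?exprn_gt0 // ler_ln ?posrE ?mulr_gt0 ?exprn_gt0 //.
by rewrite (le_trans (KP _)) // ler_wpM2l ?(ltW K0) ?sigma_prod_le_minorsum1.
Qed.

Lemma integrable_ln_minorsum_cocycle j n : (j <= d)%N ->
  intg (fun x => ln (minorsum j (B n x))).
Proof.
move=> jd; move: n.
apply: (integrable_process hf (integrable_ln_minorsum jd)) => [|n|n x|n x].
- exact: (integrable_cst (ln (minorsum j (1%:M : 'M[C]_m)))).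
- by apply: measurableT_comp; [exact: measurable_ln|exact: measurable_minorsum].
- exact: ln_minorsum_ge0.
- exact: ln_minorsumM.
Qed.

Let u j n : R := \int[mu]_x ln (minorsum j (B n x)).

Lemma int_minorsum_ge0 j n : (j <= d)%N -> 0 <= u j n.
Proof. by move=> jd; apply: Rintegral_ge0 => x _; exact: ln_minorsum_ge0. Qed.

Lemma int_minorsum_subadditive j n k : (j <= d)%N -> u j (n + k)%N <= u j n + u j k.
Proof.
move=> jd; apply: (Rintegral_process_subadditive hf (phi := fun n x => ln (minorsum j (B n x)))).
  by move=> p; exact: integrable_ln_minorsum_cocycle.
by move=> x; rewrite cocycleD; exact: ln_minorsumM.
Qed.

Let w j n : R := \int[mu]_x ln (sigma_prod j (B n x)).

Lemma integrable_ln_sigma_prod j n : (j <= d)%N -> intg (fun x => ln (sigma_prod j (B n x))).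
Proof.
move=> jd; have jm : (j <= m)%N by rewrite (leq_trans jd) // leq_addl.
apply: (le_integrable_EFin measurableT _ _ (integrable_ln_minorsum_cocycle n jd)).
  exact: measurable_ln_sigma_prod.
move=> x _; have t1 := sigma_prod_ge1 (hB n x) jd; rewrite ger0_norm ?ln_ge0 //.
have t0 : 0 < sigma_prod j (B n x) by exact: lt_le_trans t1.
have st := sigma_prod_le_minorsum (B n x) jm.
by rewrite ler_ln ?posrE // (lt_le_trans t0).
Qed.

(** A bounded perturbation disappears after division by [n]. It absorbs both the constant comparing
    [minorsum] with [sigma_prod] and the [d ln 2] of [Nfun_bounds]. *)
Lemma growth_rate_near (v v' : nat -> R) (K L : R) :
  (forall n, v n - K <= v' n <= v n) ->
  (fun n => n%:R^-1 * v n) @ \oo --> L -> (fun n => n%:R^-1 * v' n) @ \oo --> L.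
Proof.
move=> vv vL.
have Kn : (fun n => n%:R^-1 * K) @ \oo --> (0 : R).
  rewrite -(mul0r K); apply: cvgM; last exact: cvg_cst.
  by rewrite -cvg_shiftS; exact: cvg_harmonic.
apply: (@squeeze_cvgr _ _ _ _ (fun n => n%:R^-1 * v n - n%:R^-1 * K)
  (fun n => n%:R^-1 * v n)) => //.
  near=> n; have /andP[a b] := vv n.
  by rewrite -mulrBr !ler_wpM2l ?invr_ge0.
by rewrite -[X in _ --> X]subr0; apply: cvgB.
Unshelve. all: by end_near. Qed.

(** Fekete's lemma applies to the integrals of [ln (minorsum j _)], and those of
    [ln (sigma_prod j _)] stay within [ln K] of them. *)
Lemma int_sigma_prod_cvg j : (j <= d)%N -> exists L : R, (fun n => n%:R^-1 * w j n) @ \oo --> L.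
Proof.
move=> jd; have jm : (j <= m)%N by rewrite (leq_trans jd) // leq_addl.
have [L uL] := subadditive_cvg (fun n => int_minorsum_ge0 n jd) (fun n k => int_minorsum_subadditive n k jd).
have [K K0 KP] := @minorsum_le_sigma_prod R m j.
exists L; apply: (growth_rate_near (K := ln K)) uL => n.
have i1 := integrable_ln_minorsum_cocycle n jd.
have i2 := integrable_ln_sigma_prod n jd.
have t0 x : 0 < sigma_prod j (B n x) by exact: lt_le_trans (sigma_prod_ge1 (hB n x) jd).
have st x : sigma_prod j (B n x) <= minorsum j (B n x) by exact: sigma_prod_le_minorsum.
have s0 x : 0 < minorsum j (B n x) by exact: lt_le_trans (st x).
apply/andP; split; last first.
  by apply: le_Rintegral => // x _; rewrite ler_ln ?posrE.
rewrite lerBlDr.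
have -> : ln K = \int[mu]_x ln K.
  by rewrite Rintegral_cst //= probability_setT mulr1.
rewrite -RintegralD //; apply: le_Rintegral => //.
  exact: integrableD_EFin.
by move=> x _; rewrite addrC -lnM ?posrE // ler_ln ?posrE ?mulr_gt0.
Qed.

(** The logarithm of one singular value is the difference of two consecutive [ln (sigma_prod _ _)].
    That the limit is real makes the sum of exponents an ordinary one. *)
Lemma lyap_cvg k : (k < d)%N -> exists L : R,
  lyap mu f A k.+1 = L%:E /\ (fun n => n%:R^-1 * (w k.+1 n - w k n)) @ \oo --> L.
Proof.
move=> kd; have [L1 h1] := int_sigma_prod_cvg kd; have [L0 h0] := int_sigma_prod_cvg (ltnW kd).
have h : (fun n => n%:R^-1 * (w k.+1 n - w k n)) @ \oo --> L1 - L0.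
  by under eq_fun do rewrite mulrBr; exact: cvgB.
exists (L1 - L0); split => //.
rewrite /lyap; apply/cvg_lim => //.
have E n : (\int[mu]_x (ln (sigma k.+1 (cocycle f A n x)))%:E)%E = (w k.+1 n - w k n)%:E.
  rewrite -RintegralB //; try exact: integrable_ln_sigma_prod (ltnW kd).
    rewrite -[RHS]/((\int[mu]_x _)%:E) /Rintegral fineK; last first.
      apply: integrable_fin_num => //.
      by apply: integrableB_EFin;
        [exact: measurableT|exact: integrable_ln_sigma_prod|exact: integrable_ln_sigma_prod (ltnW kd)].
    apply: eq_integral => x _; congr (_%:E).
    have km : (k < m)%N by rewrite (leq_trans kd) // leq_addl.
    have -> : ln (sigma_prod k.+1 (B n x)) = ln (sigma_prod k (B n x)) + ln (sigma k.+1 (B n x)).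
      by rewrite !ln_sigma_prod ?uB ?(ltnW km) // big_ord_recr.
    by rewrite addrC addKr.
  exact: integrable_ln_sigma_prod.
under eq_fun do rewrite E -EFinM.
by apply: cvg_EFin => //; exact: nearW.
Qed.

Lemma Nfun_ge0 (T : 'M[C]_m) : Ugroup c d T -> 0 <= Nfun d T.
Proof.
move=> hT; rewrite /Nfun big_add1 /= big_mkord; apply: sumr_ge0 => i _.
have s1 := sigma_ge1 hT (ltn_ord i).
have s0 : 0 < sigma i.+1 T by exact: lt_le_trans s1.
apply: ln_ge0; rewrite ler_pdivlMr // mul1r -subr_ge0.
have -> : sigma i.+1 T + (sigma i.+1 T)^-1 - 2 = (sigma i.+1 T - 1) ^+ 2 / sigma i.+1 T.
  by field; rewrite gt_eqF.
by rewrite mulr_ge0 ?invr_ge0 ?sqr_ge0 // ltW.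
Qed.

Lemma measurable_Nfun n : measurable_fun [set: X] (fun x => Nfun d (B n x)).
Proof.
under eq_fun do rewrite Nfun_det //.
apply: measurableT_comp; first exact: measurable_ln.
apply: measurable_normc; apply: measurable_C_det => i j.
under eq_fun do rewrite !mxE.
exact: mB.
Qed.

Lemma integrable_Nfun n : intg (fun x => Nfun d (B n x)).
Proof.
apply: (le_integrable_EFin measurableT _ _ (integrable_ln_sigma_prod n (leqnn d))).
  exact: measurable_Nfun.
move=> x _; rewrite (ger0_norm (Nfun_ge0 (hB n x))) ln_sigma_prod ?leq_addl //.
by have /andP[] := Nfun_bounds (hB n x).
Qed.

Lemma ln_minorsum_cocycle_le n :
  \int[mu]_x ln (minorsum 1 (B n.+1 x)) <= n.+1%:R * \int[mu]_x ln (minorsum 1 (A x)).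
Proof.
have e : u 1 1 = \int[mu]_x ln (minorsum 1 (A x)).
  by apply: eq_Rintegral => x _; rewrite /B /= mulmx1.
apply: (@le_trans _ _ (n.+1%:R * u 1 1)); last by rewrite e.
by apply: (subadditive_le (v := u 1)) => p k; exact: int_minorsum_subadditive.
Qed.

(** A bound independent of [n], from which the dominating constant for dominated convergence is
    obtained. *)
Lemma Nfun_cocycle_le n : n%:R^-1 * \int[mu]_x Nfun d (B n x) <=
  d%:R * \int[mu]_x ln (minorsum 1 (A x)).
Proof.
have circle_mean0 : 0 <= \int[mu]_x ln (minorsum 1 (A x)).
  by apply: Rintegral_ge0 => x _; exact: ln_minorsum_ge0.
(* At [n = 0] the inverse is 0 by convention and the left-hand side vanishes. *)
case: n => [|n]; first by rewrite invr0 mul0r mulr_ge0.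
rewrite ler_pdivrMl // mulrCA.
apply: (@le_trans _ _ (d%:R * \int[mu]_x ln (minorsum 1 (B n.+1 x)))); last first.
  by rewrite ler_wpM2l // ln_minorsum_cocycle_le.
have i1 := integrable_ln_minorsum_cocycle n.+1 d0.
rewrite -RintegralZl //; apply: le_Rintegral => //.
- exact: integrable_Nfun.
- exact: integrableZl_EFin.
move=> x _; have /andP[_ h] := Nfun_bounds (hB n.+1 x).
rewrite (le_trans h) // -ln_sigma_prod ?leq_addl // mulr_natl -lnXn; last first.
  exact: lt_le_trans (minorsum_ge1 d0 (hB n.+1 x)).
rewrite ler_ln ?posrE ?exprn_gt0 ?sigma_prod_le_minorsum1 //.
  exact: lt_le_trans (sigma_prod_ge1 (hB n.+1 x) (leqnn d)).
exact: lt_le_trans (minorsum_ge1 d0 (hB n.+1 x)).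
Qed.

(** The exponents telescope to the growth rate of [ln (sigma_prod d _)], which [Nfun d] follows up
    to a bounded error. *)
Lemma lyap_sum_cvg : exists L : R, lyap_sum mu f A d = L%:E /\
  (fun n => n%:R^-1 * \int[mu]_x Nfun d (cocycle f A n x)) @ \oo --> L.
Proof.
have key j : (j <= d)%N -> exists L : R, lyap_sum mu f A j = L%:E /\
    (fun n => n%:R^-1 * w j n) @ \oo --> L.
  elim: j => [|j IH] jd.
    exists 0; rewrite /lyap_sum big_geq //; split => //.
    rewrite (_ : (fun n => _) = fun=> 0); first exact: cvg_cst.
    apply/funext => n; rewrite /w.
    under eq_Rintegral do rewrite sigma_prod0 ln1.
    by rewrite Rintegral_cst // mul0r mulr0.
  have [L [e h]] := IH (ltnW jd); have [l [e' h']] := lyap_cvg jd.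
  exists (L + l); rewrite /lyap_sum big_nat_recr //= -[X in (X + _)%E]/(lyap_sum mu f A j) e e'.
  split => //; rewrite (_ : (fun n => _) = (fun n => n%:R^-1 * w j n) \+
    (fun n => n%:R^-1 * (w j.+1 n - w j n))); first exact: cvgD h h'.
  by apply/funext => n; rewrite /= -mulrDr addrC subrK.
have [L [e h]] := key d (leqnn d); exists L; split => //.
apply: (growth_rate_near (K := d%:R * ln 2)) h => n.
have iw := integrable_ln_sigma_prod n (leqnn d).
have iN := integrable_Nfun n.
have NB x := Nfun_bounds (hB n x).
have lt x : \sum_(i < d) ln (sigma i.+1 (B n x)) = ln (sigma_prod d (B n x)).
  by rewrite ln_sigma_prod ?leq_addl.
apply/andP; split; last first.
  by apply: le_Rintegral => // x _; have := NB x; rewrite lt => /andP[].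
rewrite lerBlDr.
have -> : d%:R * ln 2 = \int[mu]_x (d%:R * ln 2) :> R.
  by rewrite Rintegral_cst //= probability_setT mulr1.
rewrite -RintegralD //; apply: le_Rintegral => //.
  exact: integrableD_EFin.
by move=> x _; have := NB x; rewrite lt lerBlDr => /andP[].
Qed.

End LyapunovExponents.

(** * Logarithmic means over the unit circle *)

Section CircleMean.
Context {R : realType}.
Local Notation C := R[i].
Local Notation leb := (@lebesgue_measure R).

Lemma continuous_itv_integrable (G : R -> R) a b : continuous G ->
  leb.-integrable `[a, b] (EFin \o G).
Proof.
move=> cG; apply: continuous_compact_integrable; first exact: segment_compact.
exact: continuous_subspaceT.
Qed.

Lemma lebesgue_measure_01 : leb `[0, 1] = 1%E.
Proof.
by have := @lebesgue_measure_itv R `[0, 1]; rewrite /= lte_fin ltr01 oppr0 adde0.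
Qed.

Lemma Rintegral_affine (G : R -> R) (k s a b : R) : 0 < k -> a <= b ->
  continuous G ->
  \int[leb]_(x in `[k * a + s, k * b + s]) G x =
  k * \int[leb]_(x in `[a, b]) G (k * x + s).
Proof.
move=> k0 ab cG; pose F x : R := k * x + s.
have cF : continuous F.
  by move=> x; apply: cvgD; [apply: cvgM; [exact: cvg_cst|exact: cvg_id]|exact: cvg_cst].
have dF x : is_derive x (1 : R) F k.
  have -> : F = (k *: (id : R -> R)) + cst s by [].
  by apply: is_derive_eq; rewrite addr0 [_ *: _]mulr1.
have F' : derive1 F = cst k.
  by apply/funext => x; rewrite derive1E derive_val.
rewrite /Rintegral (integration_by_substitution_increasing (F := F)) //.
- rewrite F' -[RHS]/(k * \int[leb]_(x in `[a, b]) (G \o F) x).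
  rewrite -RintegralZl //; last first.
    by apply: continuous_itv_integrable => x; apply: continuous_comp; [exact: cF|exact: cG].
  by apply: eq_Rintegral => x _; rewrite /= mulrC.
- by move=> x y _ _ xy; rewrite /F ltrD2r ltr_pM2l.
- by rewrite F' => x _; exact: cvg_cst.
- by rewrite F'; exact: is_cvg_cst.
- by rewrite F'; exact: is_cvg_cst.
- split.
  + by move=> x _; case: (dF x).
  + by apply: cvg_at_right_filter; exact: cF.
  + by apply: cvg_at_left_filter; exact: cF.
- exact: continuous_subspaceT.
Qed.

Lemma normc_expi2pi (t : R) : normc (expi2pi t) = 1.
Proof. by rewrite /expi2pi /= cos2Dsin2 sqrtr1. Qed.

Lemma expi2pi_half (t : R) : expi2pi (t + 1 / 2) = - expi2pi t.
Proof.
rewrite /expi2pi; have -> : 2 * pi * (t + 1 / 2) = 2 * pi * t + pi :> R by field.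
by rewrite cosDpi sinDpi.
Qed.

Lemma expi2pi_double (t : R) : expi2pi (2 * t) = expi2pi t ^+ 2.
Proof.
rewrite /expi2pi; have -> : 2 * pi * (2 * t) = 2 * pi * t + 2 * pi * t :> R by ring.
rewrite cosD sinD expr2; apply/eqP; rewrite eq_complex /=.
by rewrite eqxx /= addrC [X in _ == X]addrC [_ * cos _]mulrC.
Qed.

Let h (w : C) (t : R) : R := ln (normc (1 - w * expi2pi t)).

Lemma normc_1sub_bounds (w : C) (t : R) : normc w < 1 ->
  1 - normc w <= normc (1 - w * expi2pi t) <= 2.
Proof.
move=> w1.
have nw : normc (w * expi2pi t) = normc w.
  by rewrite ComplexField.Normc.normcM normc_expi2pi mulr1.
apply/andP; split.
  rewrite lerBlDr -{1}(@ComplexField.Normc.normc1 R) -nw.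
  by have := le_normcD (1 - w * expi2pi t) (w * expi2pi t); rewrite subrK.
apply: le_trans (le_normcD _ _) _.
by rewrite normcN nw ComplexField.Normc.normc1 -[2]/(1 + 1) lerD2l ltW.
Qed.

Lemma normc_1sub_gt0 (w : C) (t : R) : normc w < 1 ->
  0 < normc (1 - w * expi2pi t).
Proof.
by move=> w1; have /andP[+ _] := normc_1sub_bounds t w1; apply: lt_le_trans; rewrite subr_gt0.
Qed.

Lemma continuous_ln_normc_1sub (w : C) : normc w < 1 -> continuous (h w).
Proof.
move=> w1 t; rewrite /h.
apply: (@continuous_comp R R R (fun x : R => normc (1 - w * expi2pi x)) (@ln R));
  last first.
  by apply: continuous_ln; exact: normc_1sub_gt0.
case: w {w1} => a b.
pose cs (x : R) : R := cos (2 * pi * x); pose sn (x : R) : R := sin (2 * pi * x).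
have lin : continuous (fun x : R => 2 * pi * x).
  by move=> x; apply: cvgM; [exact: cvg_cst|exact: cvg_id].
have ccs : continuous cs.
  by move=> x; apply: continuous_comp; [exact: lin|exact: continuous_cos].
have csn : continuous sn.
  by move=> x; apply: continuous_comp; [exact: lin|exact: continuous_sin].
have cM (r : R) (g : R -> R) : continuous g -> continuous (fun x => r * g x).
  by move=> cg x; apply: cvgM; [exact: cvg_cst|exact: cg].
have c1 : continuous (fun x : R => 1 - (a * cs x - b * sn x)).
  by move=> x; apply: cvgB; [exact: cvg_cst|apply: cvgB; exact: cM].
have c2 : continuous (fun x : R => 0 - (a * sn x + b * cs x)).
  by move=> x; apply: cvgB; [exact: cvg_cst|apply: cvgD; exact: cM].
have : continuous (fun x : R => Num.sqrt ((1 - (a * cs x - b * sn x)) ^+ 2 +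
   (0 - (a * sn x + b * cs x)) ^+ 2)).
  move=> x; apply: continuous_comp; last exact: sqrt_continuous.
  by apply: cvgD; apply: cvgM; [exact: c1|exact: c1|exact: c2|exact: c2].
exact.
Qed.

Let I (w : C) : R := \int[leb]_(t in `[0, 1]) h w t.

(** Rescaling turns the left-hand side into twice an integral over [[0, 1/2]], whose integrand
    splits by the factorization of a difference of two squares; the second factor is the first one
    moved by a half turn, so its integral supplies the other half of the circle. *)
Lemma circle_mean_double (w : C) : normc w < 1 -> I (w ^+ 2) = 2 * I w.
Proof.
move=> w1.
have w21 : normc (w ^+ 2) < 1.
  by rewrite expr2 ComplexField.Normc.normcM mulr_ilt1 ?normc_ge0.
have ch := continuous_ln_normc_1sub w1; have ch2 := continuous_ln_normc_1sub w21.
rewrite /I.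
have := @Rintegral_affine (h (w ^+ 2)) 2 0 0 (1 / 2).
rewrite mulr0 addr0 addr0 mulrCA mulfV // mulr1 => -> //; congr (_ * _).
have e t : h (w ^+ 2) (2 * t + 0) = h w t + h w (1 * t + 1 / 2).
  rewrite addr0 mul1r /h -lnM ?posrE ?normc_1sub_gt0 // -ComplexField.Normc.normcM.
  congr (ln (normc _)); rewrite expi2pi_double expi2pi_half; ring.
under eq_Rintegral do rewrite e.
have cs : continuous (fun t : R => h w (1 * t + 1 / 2)).
  move=> x; apply: continuous_comp; last exact: ch.
  by apply: cvgD; [apply: cvgM; [exact: cvg_cst|exact: cvg_id]|exact: cvg_cst].
rewrite RintegralD //; [|exact: continuous_itv_integrable..].
rewrite -[X in _ + X]mul1r -Rintegral_affine //.
rewrite (_ : 1 * 0 + 1 / 2 = 1 / 2); last by field.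
rewrite (_ : 1 * (1 / 2) + 1 / 2 = 1); last by field.
have := @Rintegral_itvB R (h w) (BLeft 0) (BRight 1) (1 / 2) (continuous_itv_integrable 0 1 ch).
rewrite !bnd_simp => /(_ _ _)/eqP; rewrite subr_eq addrC => h1.
(* The subtraction formula yields a half-open interval; the missing endpoint is negligible. *)
rewrite -[X in _ + X]Rintegral_itv_obnd_cbnd; last first.
  apply: integrableS (continuous_itv_integrable (1 / 2) 1 ch) => //.
  by apply: subset_itvr; rewrite bnd_simp.
by apply/esym/eqP/h1; [rewrite divr_ge0|rewrite ler_pdivrMr // mul1r ler1n].
Qed.

(** Iterated doubling gives [I (w ^+ (2 ^ n)) = 2 ^+ n * I w], while the left-hand side is bounded
    uniformly in [n]. *)
Lemma circle_mean0 (w : C) : normc w < 1 -> I w = 0.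
Proof.
move=> w1.
(* Positive powers of [w] have modulus at most that of [w], so [1 - normc w] and 2 bound the modulus
   inside the logarithm for all of them. *)
pose K : R := Num.max (ln 2) (- ln (1 - normc w)).
have bnd n : `|I (w ^+ n.+1)| <= K.
  have nX : normc (w ^+ n.+1) <= normc w.
    elim: n => [|n IH] //; rewrite exprS ComplexField.Normc.normcM.
    by rewrite ler_piMr ?normc_ge0 // (le_trans IH) // ltW.
  have wn1 : normc (w ^+ n.+1) < 1 by exact: le_lt_trans w1.
  have ch := continuous_ln_normc_1sub wn1.
  apply: le_trans (le_normr_Rintegral _ _) _ => //.
    exact: continuous_itv_integrable.
  have -> : K = \int[leb]_(t in `[0, 1]) K.
    by rewrite Rintegral_cst // (_ : fine _ = 1) ?mulr1 //; exact: (congr1 fine lebesgue_measure_01).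
  apply: le_Rintegral => //.
  - apply: continuous_itv_integrable => x.
    by apply: continuous_comp; [exact: ch|exact: norm_continuous].
  - by apply: continuous_itv_integrable => x; exact: cvg_cst.
  move=> t _; have /andP[l u] := normc_1sub_bounds t wn1.
  have p := normc_1sub_gt0 t wn1.
  rewrite ler_norml lerNl /h; apply/andP; split.
    rewrite /K le_max; apply/orP; right; rewrite lerN2 ler_ln ?posrE ?subr_gt0 //.
    by rewrite (le_trans _ l) // lerB.
  by rewrite /K le_max ler_ln ?posrE // u.
have dbl n : I (w ^+ (2 ^ n)) = 2 ^+ n * I w.
  elim: n => [|n IH]; first by rewrite expr0 mul1r.
  rewrite expnSr exprM circle_mean_double ?IH ?exprS ?mulrA //.
  have : (0 < 2 ^ n)%N by rewrite expn_gt0.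
  case: (2 ^ n)%N => // k _; elim: k => [|k IHk] //.
  by rewrite exprS ComplexField.Normc.normcM mulr_ilt1 ?normc_ge0.
apply/eqP; rewrite -normr_eq0 eq_le normr_ge0 andbT leNgt; apply/negP => circle_mean0.
(* Since [2 ^ n] exceeds [n], an integer above the quotient makes the doubled value larger than
   [K]. *)
have := archi_boundP (_ : 0 <= K / `|I w|).
have K0 : 0 <= K by exact: le_trans (bnd 0%N).
rewrite divr_ge0 // => /(_ isT); set n := Num.bound _; rewrite ltr_pdivrMr // => Kn.
have : 2 ^+ n * `|I w| <= K.
  rewrite -[2 ^+ n]ger0_norm ?exprn_ge0 // -normrM -dbl.
  by have : (0 < 2 ^ n)%N; [rewrite expn_gt0|case: (2 ^ n)%N => // k _; exact: bnd].
apply/negP; rewrite -ltNge (lt_le_trans Kn) // ler_wpM2r //.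
by rewrite -natrX ler_nat ltnW // ltn_expl.
Qed.

Lemma Rintegral_cst01 (r : R) : \int[leb]_(t in `[0, 1]) r = r.
Proof.
by rewrite Rintegral_cst // (_ : fine _ = 1) ?mulr1 //; exact: (congr1 fine lebesgue_measure_01).
Qed.

(** Factoring out [-z] leaves [1 - z^-1 * expi2pi t], with the inverse inside the disk. *)
Lemma mean_ln_normc_XsubC (z : C) : 1 < normc z ->
  leb.-integrable `[0, 1] (EFin \o (fun t => ln (normc (expi2pi t - z)))) /\
  \int[leb]_(t in `[0, 1]) ln (normc (expi2pi t - z)) = ln (normc z).
Proof.
move=> z1; have z0 : z != 0.
  by rewrite -normc_eq0 gt_eqF // (lt_trans _ z1).
have w1 : normc z^-1 < 1 by rewrite ComplexField.Normc.normcV invf_lt1 // (lt_trans _ z1).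
have nz0 : 0 < normc z by exact: lt_trans z1.
have e t : ln (normc (expi2pi t - z)) = ln (normc z) + h z^-1 t.
  rewrite /h -lnM ?posrE ?normc_1sub_gt0 // -ComplexField.Normc.normcM.
  by rewrite mulrBr mulr1 mulVKf // -normcN opprB.
have ch := continuous_ln_normc_1sub w1.
have i1 : leb.-integrable `[0, 1] (EFin \o (fun _ : R => ln (normc z))).
  by apply: continuous_itv_integrable => x; exact: cvg_cst.
have i2 := continuous_itv_integrable 0 1 ch.
have -> : (fun t => ln (normc (expi2pi t - z))) = (fun t => ln (normc z) + h z^-1 t).
  exact/funext.
split; first exact: integrableD_EFin.
by rewrite RintegralD // Rintegral_cst01 -[X in _ + X]/(I z^-1) circle_mean0 ?addr0.
Qed.

(** Jensen's formula without zeros in the closed disk, by splitting into linear factors.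
    Integrability is carried along because the integral is additive only on integrable functions. *)
Lemma mean_ln_normc_poly (p : {poly C}) :
  (forall z, normc z <= 1 -> p.[z] != 0) ->
  leb.-integrable `[0, 1] (EFin \o (fun t => ln (normc p.[expi2pi t]))) /\
  \int[leb]_(t in `[0, 1]) ln (normc p.[expi2pi t]) = ln (normc p.[0]).
Proof.
move=> pz; have [r pE] := closed_field_poly_normal p.
have lp0 : lead_coef p != 0.
  rewrite lead_coef_eq0; apply/eqP => p0.
  by have := pz 0; rewrite p0 horner0 eqxx ComplexField.Normc.normc0 => /(_ ler01).
have rgt z : z \in r -> 1 < normc z.
  move=> zr; rewrite ltNge; apply/negP => /pz /negP; apply; rewrite pE hornerZ mulf_eq0.
  by rewrite -rootE root_prod_XsubC zr orbT.
have qz (s : seq C) x : (forall z, z \in s -> 1 < normc z) -> normc x <= 1 ->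
    0 < normc (\prod_(z <- s) ('X - z%:P)).[x].
  move=> s1 x1; rewrite lt0r normc_ge0 andbT normc_eq0 horner_prod.
  rewrite prodf_seq_neq0; apply/allP => z zs /=; rewrite hornerXsubC subr_eq0.
  by apply/negP => /eqP xz; have := s1 z zs; rewrite -xz ltNge x1.
have e1 (t : R) : normc (expi2pi t) <= 1 by rewrite normc_expi2pi.
have n01 : normc (0 : C) <= 1 by rewrite ComplexField.Normc.normc0.
have key (s : seq C) : (forall z, z \in s -> 1 < normc z) ->
    leb.-integrable `[0, 1]
      (EFin \o (fun t => ln (normc (\prod_(z <- s) ('X - z%:P)).[expi2pi t]))) /\
    \int[leb]_(t in `[0, 1]) ln (normc (\prod_(z <- s) ('X - z%:P)).[expi2pi t]) =
    ln (normc (\prod_(z <- s) ('X - z%:P)).[0]).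
  elim: s => [|z s IH] s1.
    have -> : (fun t => ln (normc (\prod_(z <- [::]) ('X - z%:P)).[expi2pi t])) = fun _ : R => 0.
      by apply/funext => t; rewrite big_nil hornerC ComplexField.Normc.normc1 ln1.
    rewrite big_nil hornerC ComplexField.Normc.normc1 ln1 Rintegral_cst01; split => //.
    by apply: continuous_itv_integrable => x; exact: cvg_cst.
  have s1' y : y \in s -> 1 < normc y by move=> ys; rewrite s1 // inE ys orbT.
  have z1 : 1 < normc z by rewrite s1 // mem_head.
  have [i1 e1'] := IH s1'; have [i2 e2] := mean_ln_normc_XsubC z1.
  have zE x : normc x <= 1 -> ln (normc (\prod_(z <- z :: s) ('X - z%:P)).[x]) =
      ln (normc (x - z)) + ln (normc (\prod_(z <- s) ('X - z%:P)).[x]).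
    move=> x1; rewrite big_cons hornerM ComplexField.Normc.normcM hornerXsubC lnM ?posrE ?qz //.
    have zz y : y \in [:: z] -> 1 < normc y by rewrite inE => /eqP->.
    by have := qz [:: z] x zz x1; rewrite big_seq1 hornerXsubC.
  have -> : (fun t => ln (normc (\prod_(z <- z :: s) ('X - z%:P)).[expi2pi t])) =
      (fun t => ln (normc (expi2pi t - z)) + ln (normc (\prod_(z <- s) ('X - z%:P)).[expi2pi t])).
    by apply/funext => t; exact: zE.
  split; first exact: integrableD_EFin.
  by rewrite RintegralD // e1' e2 zE // sub0r normcN.
have [i1 e1'] := key r rgt.
have pxE x : normc x <= 1 -> ln (normc p.[x]) =
    ln (normc (lead_coef p)) + ln (normc (\prod_(z <- r) ('X - z%:P)).[x]).
  move=> x1; rewrite {1}pE hornerZ ComplexField.Normc.normcM lnM ?posrE ?qz //.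
  by rewrite lt0r normc_ge0 normc_eq0 lp0.
have -> : (fun t => ln (normc p.[expi2pi t])) = (fun t => ln (normc (lead_coef p)) +
    ln (normc (\prod_(z <- r) ('X - z%:P)).[expi2pi t])).
  by apply/funext => t; exact: pxE.
have i0 : leb.-integrable `[0, 1] (EFin \o (fun _ : R => ln (normc (lead_coef p)))).
  by apply: continuous_itv_integrable => x; exact: cvg_cst.
split; first exact: integrableD_EFin.
by rewrite RintegralD // e1' Rintegral_cst01 pxE.
Qed.

End CircleMean.

(** * The twisted product as a polynomial in the twisting parameter *)

Section TwistedProduct.
Variables (c d : nat).

(* For [z = expi2pi t] this is the cocycle of [Utheta c d t *m A]. *)
Fixpoint twist_prod (F : nzRingType) (As : nat -> 'M[F]_(c + d)) (z : F) (n : nat) :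
    'M[F]_(c + d) :=
  if n is k.+1 then block_mx z%:M 0 0 1%:M *m As k *m twist_prod As z k else 1%:M.

(** The same recursion is run over polynomials with ['X] as parameter; evaluation at [z] is a ring
    morphism, hence commutes with products, blocks and determinants. *)
Lemma twist_prod_poly (F : comNzRingType) (As : nat -> 'M[F]_(c + d)) n :
  exists p : {poly F}, forall z, p.[z] = \det (drsubmx (twist_prod As z n)).
Proof.
pose Ap k := map_mx polyC (As k).
exists (\det (drsubmx (twist_prod Ap 'X n))) => z.
rewrite -[LHS]/(horner_eval z _) -det_map_mx map_drsubmx; congr (\det (drsubmx _)).
elim: n => [|n IH] /=; first by rewrite map_mx1.
rewrite !map_mxM /= IH map_block_mx !map_mx0 map_mx1 map_scalar_mx /=.
rewrite /horner_eval hornerX; congr (_ *m _ *m _).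
by apply/matrixP => i j; rewrite !mxE /horner_eval hornerC.
Qed.

(** At 0 the twist erases the upper rows, so the lower right blocks simply multiply. The invariant
    is the vanishing of the upper right block, which the initial identity matrix also satisfies. *)
Lemma det_twist_prod0 (F : comNzRingType) (As : nat -> 'M[F]_(c + d)) n :
  \det (drsubmx (twist_prod As 0 n)) = \prod_(k < n) \det (drsubmx (As k)).
Proof.
have step (M N : 'M[F]_(c + d)) : ursubmx N = 0 ->
    ursubmx (block_mx 0%:M 0 0 1%:M *m M *m N) = 0 /\
    drsubmx (block_mx 0%:M 0 0 1%:M *m M *m N) = drsubmx M *m drsubmx N.
  move=> N0; rewrite -[M]submxK -[N]submxK N0 !mulmx_block.
  have -> : 0%:M = 0 :> 'M[F]_c by rewrite raddf0.
  by rewrite !(block_mxKur, block_mxKdr, mul0mx, mulmx0, mul1mx, add0r, addr0).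
have ur0 k : ursubmx (twist_prod As 0 k) = 0.
  elim: k => [|k IH] /=; last by have [] := step (As k) _ IH.
  by rewrite scalar_mx_block block_mxKur.
elim: n => [|n IH] /=.
  by rewrite big_ord0 scalar_mx_block block_mxKdr det1.
have [_ ->] := step (As n) _ (ur0 n).
by rewrite det_mulmx IH big_ord_recr mulrC.
Qed.

End TwistedProduct.

(** * Monotonicity of the indefinite form and zero-free twisted minors *)

Section Contraction.
Context {R : realType} {c d : nat}.
Local Notation C := R[i].
Local Notation m := (c + d)%N.
Local Notation G := (@Gform R c d).

Definition sqnorm (k : nat) (v : 'cV[C]_k) : R := \sum_i normc (v i 0) ^+ 2.

Lemma sqnorm_ge0 k (v : 'cV[C]_k) : 0 <= sqnorm v.
Proof. by apply: sumr_ge0 => i _; exact: sqr_ge0. Qed.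

Lemma sqnorm_eq0 k (v : 'cV[C]_k) : sqnorm v = 0 -> v = 0.
Proof.
move=> /eqP; rewrite psumr_eq0 => [/allP v0|i _]; last exact: sqr_ge0.
apply/matrixP => i j; rewrite ord1 mxE; apply/eqP.
by have := v0 i (mem_index_enum i); rewrite /= sqrf_eq0 normc_eq0.
Qed.

Lemma sqnormE k (v : 'cV[C]_k) : (sqnorm v)%:C%C = (v ^t* *m v) 0 0.
Proof.
rewrite mxE rmorph_sum /=; apply: eq_bigr => i _.
by rewrite normc_sqr !mxE.
Qed.

Definition qform (v : 'cV[C]_m) : R := sqnorm (usubmx v) - sqnorm (dsubmx v).

Lemma qformE (v : 'cV[C]_m) : (qform v)%:C%C = (v ^t* *m G *m v) 0 0.
Proof.
rewrite /qform rmorphB /= !sqnormE -[in RHS](vsubmxK v) tr_col_mx map_row_mx.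
rewrite /Gform mul_row_block !mulmx0 addr0 add0r mulmx1 mulmxN mulmx1.
by rewrite mul_row_col mulNmx !mxE.
Qed.

Lemma qform_Ugroup (T : 'M[C]_m) v : Ugroup c d T -> qform (T *m v) = qform v.
Proof.
move=> hT; apply: complexI; rewrite !qformE trmx_mul map_mxM /= -!mulmxA.
by rewrite (mulmxA G) (mulmxA (T ^t* )) (mulmxA (T ^t* )) hT.
Qed.

(** The twist shrinks the positive part of the form and leaves the negative part alone. *)
Lemma qform_contract (z : C) v : normc z <= 1 ->
  qform (block_mx z%:M 0 0 1%:M *m v) <= qform v.
Proof.
move=> z1; rewrite /qform -[v]vsubmxK mul_block_col !mul0mx addr0 add0r mul1mx.
rewrite mul_scalar_mx !col_mxKu !col_mxKd lerD2r; apply: ler_sum => i _.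
rewrite !mxE ComplexField.Normc.normcM exprMn ler_piMl ?sqr_ge0 //.
by rewrite expr_le1 ?normc_ge0.
Qed.

Lemma qform_twist_prod (As : nat -> 'M[C]_m) (z : C) n v :
  (forall k, Ugroup c d (As k)) -> normc z <= 1 ->
  qform (twist_prod As z n *m v) <= qform v.
Proof.
move=> hA z1; elim: n v => [|n IH] v /=; first by rewrite mul1mx.
rewrite -!mulmxA (le_trans (qform_contract _ z1)) //.
by rewrite qform_Ugroup.
Qed.

(* A vector [(0, w)] with [w <> 0] is negative for the form, hence cannot be
   sent to the nonnegative vector [(_, 0)]. *)
Lemma det_twist_prod_neq0 (As : nat -> 'M[C]_m) (z : C) n :
  (forall k, Ugroup c d (As k)) -> normc z <= 1 ->
  \det (drsubmx (twist_prod As z n)) != 0.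
Proof.
move=> hA z1; set T := twist_prod As z n; rewrite -det_tr.
apply/negP => /det0P[w w0 wD].
have Dw : drsubmx T *m w^T = 0 by rewrite -[LHS]trmxK trmx_mul trmxK wD trmx0.
have := qform_twist_prod n (col_mx 0 w^T) hA z1.
rewrite /qform -/T -[T]submxK mul_block_col !mulmx0 !add0r Dw.
rewrite !col_mxKu !col_mxKd.
have s0 k : sqnorm (0 : 'cV[C]_k) = 0.
  by rewrite /sqnorm big1 // => i _; rewrite mxE ComplexField.Normc.normc0 expr0n.
rewrite !s0 subr0 sub0r => h; have := sqnorm_ge0 w^T.
have : sqnorm w^T <= 0 by rewrite -oppr_ge0 (le_trans _ h) ?sqnorm_ge0.
move=> h1 h2; case/negP: w0; apply/eqP/trmx_inj; rewrite trmx0.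
by apply/sqnorm_eq0/eqP; rewrite eq_le h1 h2.
Qed.

Lemma Utheta_Ugroup (t : R) : Ugroup c d (Utheta c d t).
Proof.
rewrite /Ugroup /= /Utheta /Gform tr_block_mx map_block_mx !trmx0 !map_mx0.
rewrite !tr_scalar_mx map_scalar_mx map_mx1 !mulmx_block.
rewrite !(mul0mx, mulmx0, mul1mx, mulmx1, add0r, addr0) -scalar_mxM.
have -> : (expi2pi t)^* * expi2pi t = 1.
  by rewrite -normc_sqr normc_expi2pi expr1n.
by [].
Qed.

Lemma Nfun_twist_mean (As : nat -> 'M[C]_m) n :
  (forall k, Ugroup c d (As k)) ->
  let F t := ln (normc (\det (drsubmx (twist_prod As (expi2pi t) n)))) in
  (@lebesgue_measure R).-integrable `[0, 1] (EFin \o F) /\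
  \int[@lebesgue_measure R]_(t in `[0, 1]) F t = \sum_(k < n) Nfun d (As k).
Proof.
move=> hA F; have [p pE] := twist_prod_poly As n.
have FE t : F t = ln (normc p.[expi2pi t]) by rewrite /F pE.
have pz z : normc z <= 1 -> p.[z] != 0 by rewrite pE; exact: det_twist_prod_neq0.
have [i1 e1] := mean_ln_normc_poly pz.
have -> : F = fun t => ln (normc p.[expi2pi t]) by exact/funext.
split => //; rewrite e1 pE det_twist_prod0.
(* Nonvanishing for the one-step product at the parameter 0, where it reduces to a single block. *)
have g0 k : 0 < normc (\det (drsubmx (As k))).
  rewrite lt0r normc_ge0 andbT normc_eq0.
  have := det_twist_prod_neq0 1 (fun _ => hA k) (_ : normc 0 <= 1).
  rewrite ComplexField.Normc.normc0 det_twist_prod0 big_ord1; exact.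
elim: n {F p pE pz FE i1 e1} => [|n IH].
  by rewrite !big_ord0 ComplexField.Normc.normc1 ln1.
rewrite !big_ord_recr /= ComplexField.Normc.normcM lnM ?posrE //.
  by rewrite IH Nfun_det.
apply: (big_ind (fun x : C => 0 < normc x)) => //.
  by rewrite ComplexField.Normc.normc1.
by move=> x y x0 y0; rewrite ComplexField.Normc.normcM mulr_gt0.
Qed.

End Contraction.

(** * Entries against the operator norm *)

Section OperatorNorm.
Context {R : realType}.
Local Notation C := R[i].

Lemma minor_1 (k : nat) (f g : 'I_1 -> 'I_k) (T : 'M[C]_k) :
  \det (mxsub f g T) = T (f 0) (g 0).
Proof. by rewrite det_mx11 mxE. Qed.

Lemma l2normE (k : nat) (v : 'cV[C]_k) : l2norm v = Num.sqrt (sqnorm v).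
Proof. by rewrite /l2norm; under eq_bigr do rewrite -normc_normr. Qed.

Lemma entry_le_l2norm (k : nat) (v : 'cV[C]_k) i : normc (v i 0) <= l2norm v.
Proof.
rewrite l2normE -(ger0_norm (normc_ge0 (v i 0))) -sqrtr_sqr ler_sqrt ?sqnorm_ge0 //.
by rewrite /sqnorm (bigD1 i) //= lerDl sumr_ge0 // => j _; exact: sqr_ge0.
Qed.

Lemma entry_le_opnorm (k : nat) (T : 'M[C]_k) i j : normc (T i j) <= opnorm T.
Proof.
(* A crude bound showing that the set defining [opnorm] is bounded; without it the supremum would
   not dominate its elements. *)
pose B : R := \sum_i \sum_j normc (T i j).
have B0 : 0 <= B by apply: sumr_ge0 => a _; apply: sumr_ge0 => b _; exact: normc_ge0.
pose e : 'cV[C]_k := delta_mx j 0.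
have e1 : l2norm e <= 1.
  rewrite l2normE /sqnorm (bigD1 j) //= big1 => [|a aj].
    by rewrite !mxE !eqxx ComplexField.Normc.normc1 expr1n addr0 sqrtr1.
  by rewrite !mxE (negPf aj) ComplexField.Normc.normc0 expr0n.
have -> : T i j = (T *m e) i 0.
  rewrite mxE (bigD1 j) //= big1 ?addr0 => [|a aj]; rewrite !mxE ?eqxx ?mulr1 //.
  by rewrite (negPf aj) mulr0.
apply: le_trans (entry_le_l2norm _ i) _; apply: ub_le_sup; last by exists e.
exists (Num.sqrt (\sum_(a < k) B ^+ 2)) => _ [v v1 <-].
rewrite l2normE ler_sqrt; last by apply: sumr_ge0 => a _; exact: sqr_ge0.
apply: ler_sum => a _; rewrite lerXn2r ?nnegrE ?normc_ge0 //.
rewrite mxE (le_trans (normc_sum _)) //.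
apply: (@le_trans _ _ (\sum_b normc (T a b))); last first.
  rewrite /B [leRHS](bigD1 a) //= lerDl; apply: sumr_ge0 => b _.
  by apply: sumr_ge0 => b' _; exact: normc_ge0.
apply: ler_sum => b _; rewrite ComplexField.Normc.normcM ler_piMr ?normc_ge0 //.
by rewrite (le_trans (entry_le_l2norm _ _)).
Qed.

Lemma minorsum1_le_opnorm (k : nat) (T : 'M[C]_k) :
  minorsum 1 T <= (k ^ 2)%:R * opnorm T.
Proof.
rewrite /minorsum.
apply: (@le_trans _ _ (\sum_(f : {ffun 'I_1 -> 'I_k}) \sum_(g : {ffun 'I_1 -> 'I_k}) opnorm T)).
  by apply: ler_sum => f _; apply: ler_sum => g _; rewrite minor_1 entry_le_opnorm.
by rewrite !sumr_const card_ffun !card_ord !expn1 -mulrnA mulr_natl.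
Qed.

(** The rotation multiplies rows by numbers of modulus 1. This makes all the estimates uniform in
    [t]. *)
Lemma minorsum1_Utheta (c d : nat) (t : R) (T : 'M[C]_(c + d)) :
  minorsum 1 (Utheta c d t *m T) = minorsum 1 T.
Proof.
apply: eq_bigr => f _; apply: eq_bigr => g _; rewrite !minor_1.
rewrite -[T in LHS]vsubmxK /Utheta mul_block_col !mul0mx addr0 add0r mul1mx.
rewrite mul_scalar_mx -[T in RHS]vsubmxK !mxE; case: (fintype.split _) => a; rewrite ?mxE //.
by rewrite ComplexField.Normc.normcM normc_expi2pi mul1r.
Qed.

End OperatorNorm.

(** * Averaging over the rotation angle *)

Section Averaging.
#[local] Opaque minorsum sigma_prod sigma Nfun.
Context {R : realType} {c d : nat} {disp : measure_display} {X : measurableType disp}.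
Local Notation C := R[i].
Local Notation m := (c + d)%N.
Local Notation leb := (@lebesgue_measure R).
Local Notation Rm := (measurableTypeR R).
Variables (mu : probability X R) (f : X -> X) (A : X -> 'M[C]_m).
Hypotheses (d0 : (0 < d)%N) (hf : measure_preserving mu f)
  (hA : forall x, Ugroup c d (A x)) (mA : measurable_mx A)
  (iA : mu.-integrable [set: X] (fun x => (ln (opnorm (A x)))%:E)).
Local Notation intg g := (mu.-integrable [set: X] (EFin \o g)).

Let twist (t : R) x := Utheta c d t *m A x.

Lemma twist_cocycle t n x :
  cocycle f (twist t) n x = twist_prod (fun k => A (iter k f x)) (expi2pi t) n.
Proof. by elim: n => [|n IH] //=; rewrite IH. Qed.

Lemma twist_Ugroup t x : Ugroup c d (twist t x).
Proof. by apply: UgroupM; [exact: Utheta_Ugroup|exact: hA]. Qed.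

(** Passes from the operator norm to the sum of the moduli of the entries, the quantity controlling
    the exponents above. *)
Lemma integrable_ln_minorsum1 : intg (fun x => ln (minorsum 1 (A x))).
Proof.
have ig : intg (fun x => ln ((m ^ 2)%:R) + ln (opnorm (A x))).
  apply: integrableD_EFin; [exact: measurableT| |exact: iA].
  exact: finite_measure_integrable_cst.
apply: (le_integrable_EFin measurableT _ _ ig).
  by apply: measurableT_comp; [exact: measurable_ln|exact: measurable_minorsum].
move=> x _; have s1 := minorsum_ge1 d0 (hA x).
rewrite ger0_norm ?ln_ge0 //.
have s0 : 0 < minorsum 1 (A x) by exact: lt_le_trans s1.
have m20 : 0 < (m ^ 2)%:R :> R by rewrite ltr0n expn_gt0 addn_gt0 d0 orbT.
have so := minorsum1_le_opnorm (A x).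
have o0 : 0 < opnorm (A x) by rewrite -(pmulr_rgt0 _ m20) (lt_le_trans s0).
by rewrite -lnM ?posrE // ler_ln ?posrE ?mulr_gt0.
Qed.

Lemma measurable_C_expi2pi : measurable_C (fun t : Rm => expi2pi t).
Proof.
have lin : measurable_fun [set: Rm] (fun t : Rm => 2 * pi * t).
  by apply: measurable_funM.
split => /=.
  by apply: measurableT_comp lin; apply: continuous_measurable_fun; exact: continuous_cos.
by apply: measurableT_comp lin; apply: continuous_measurable_fun; exact: continuous_sin.
Qed.

Lemma measurable_C_comp d1 d2 (Y : measurableType d1) (Z : measurableType d2)
    (g : Y -> Z) (h : Z -> C) :
  measurable_fun [set: Y] g -> measurable_C h -> measurable_C (h \o g).
Proof.
move=> mg [h1 h2]; split; [exact: (measurableT_comp h1 mg)|exact: (measurableT_comp h2 mg)].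
Qed.

Lemma measurable_twist : measurable_mx (fun tx : Rm * X => twist tx.1 tx.2).
Proof.
have mU i k : measurable_C (fun t : Rm => Utheta c d t i k).
  rewrite /Utheta; under eq_fun do rewrite !mxE.
  case: (fintype.split i) => a; under eq_fun do rewrite !mxE.
    case: (fintype.split k) => b; under eq_fun do rewrite !mxE.
      case: (a == b); last exact: measurable_C_cst.
      exact: measurable_C_expi2pi.
    exact: measurable_C_cst.
  by case: (fintype.split k) => b; under eq_fun do rewrite !mxE; exact: measurable_C_cst.
move=> i j; suff : measurable_C (fun tx : Rm * X => twist tx.1 tx.2 i j) by [].
under eq_fun do rewrite mxE.
apply: measurable_C_sum => k; apply: measurable_CM.
  exact: (measurable_C_comp (h := fun t : Rm => Utheta c d t i k) measurable_fst).
exact: (measurable_C_comp (h := fun x => A x k j) measurable_snd).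
Qed.

Let Phi n (tx : Rm * X) : R := Nfun d (cocycle f (twist tx.1) n tx.2).

(** Joint measurability, required by Tonelli's theorem: the twisted iterates form a single cocycle
    over the map sending [(t, x)] to [(t, f x)]. *)
Lemma measurable_Phi n : measurable_fun [set: Rm * X] (Phi n).
Proof.
have -> : Phi n = fun tx => ln (normc (\det (drsubmx
    (cocycle (fun tx => (tx.1, f tx.2)) (fun tx : Rm * X => twist tx.1 tx.2) n tx)))).
  apply/funext => -[t x]; rewrite /Phi Nfun_det; last first.
    by apply: Ugroup_cocycle => y; exact: twist_Ugroup.
  congr (ln (normc (\det (drsubmx _)))) => /=.
  elim: n => [|n IH] //=; rewrite IH; congr (_ *m _).
  have -> : iter n (fun tx => (tx.1, f tx.2)) (t, x) = (t, iter n f x).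
    by elim: n {IH} => [|n IH] //=; rewrite IH.
  by [].
apply: measurableT_comp; first exact: measurable_ln.
apply: measurable_normc; apply: measurable_C_det => i j.
under eq_fun do rewrite !mxE.
apply: measurable_mx_cocycle; last exact: measurable_twist.
apply/measurable_fun_pairP; split => /=; first exact: measurable_fst.
exact: measurableT_comp hf.1 measurable_snd.
Qed.

Lemma Phi_ge0 n t x : 0 <= Phi n (t, x).
Proof. by apply: Nfun_ge0; apply: Ugroup_cocycle => y; exact: twist_Ugroup. Qed.

Lemma integrable_ln_minorsum1_twist t :
  intg (fun x => ln (minorsum 1 (twist t x))).
Proof.
under eq_fun do rewrite /twist minorsum1_Utheta.
exact: integrable_ln_minorsum1.
Qed.

Lemma measurable_mx_twist t : measurable_mx (twist t).
Proof. by apply: measurable_mx_mul => //; exact: measurable_mx_cst. Qed.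

Lemma integrable_Phi n t : intg (fun x => Phi n (t, x)).
Proof.
exact: (integrable_Nfun d0 hf (twist_Ugroup t) (measurable_mx_twist t)
  (integrable_ln_minorsum1_twist t) n).
Qed.

Lemma integrable_Nfun_map : intg (fun x => Nfun d (A x)).
Proof.
have := integrable_Nfun d0 hf hA mA integrable_ln_minorsum1 1.
by under eq_fun do rewrite /= mulmx1.
Qed.

Let a n (t : R) : R := n%:R^-1 * \int[mu]_x Phi n (t, x).
Let J : R := \int[mu]_x Nfun d (A x).

Lemma Rintegral_birkhoff_Nfun n :
  intg (fun x => \sum_(k < n) Nfun d (A (iter k f x))) /\
  \int[mu]_x (\sum_(k < n) Nfun d (A (iter k f x))) = n%:R * J.
Proof.
elim: n => [|n [IH1 IH2]].
  have e : (fun x => \sum_(k < 0) Nfun d (A (iter k f x))) = fun _ => 0.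
    by apply/funext => x; rewrite big_ord0.
  rewrite e mul0r Rintegral_cst // mul0r; split => //.
  exact: finite_measure_integrable_cst.
have e : (fun x => \sum_(k < n.+1) Nfun d (A (iter k f x))) =
    fun x => \sum_(k < n) Nfun d (A (iter k f x)) + Nfun d (A (iter n f x)).
  by apply/funext => x; rewrite big_ord_recr.
have i1 := integrable_mp_iter hf n integrable_Nfun_map.
rewrite e; split; first exact: (integrableD_EFin measurableT IH1 i1).
rewrite (RintegralD measurableT IH1 i1) IH2 /=.
have -> : \int[mu]_x Nfun d (A (iter n f x)) = J.
  exact: (Rintegral_mp_iter hf n integrable_Nfun_map).
by rewrite -natr1 mulrDl mul1r.
Qed.

Lemma mean_Phi n x :
  (\int[leb]_(t in `[0%R, 1%R]) (Phi n (t, x))%:E =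
   (\sum_(k < n) Nfun d (A (iter k f x)))%:E)%E.
Proof.
have [i1 e1] := Nfun_twist_mean n (fun k => hA (iter k f x)).
rewrite -e1 /Rintegral fineK; last exact: integrable_fin_num.
apply: eq_integral => t _; rewrite /Phi Nfun_det ?twist_cocycle //.
by rewrite -twist_cocycle; apply: Ugroup_cocycle => y; exact: twist_Ugroup.
Qed.

Lemma integral_Phi n :
  (\int[leb]_(t in `[0%R, 1%R]) \int[mu]_x (Phi n (t, x))%:E = (n%:R * J)%:E)%E.
Proof.
pose D : set Rm := [set` `[0%R, 1%R]].
(* The indicator extends the integrand to the whole line, since Tonelli's theorem is applied on the
   full product space. *)
pose Psi (tx : Rm * X) : \bar R := (\1_D tx.1 * Phi n tx)%:E.
have mPsi : measurable_fun [set: Rm * X] Psi.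
  apply/measurable_EFinP; apply: measurable_funM; last exact: measurable_Phi.
  have mD : measurable_fun [set: Rm] (\1_D : Rm -> R).
    by apply: measurable_indic; exact: measurable_itv.
  exact: (measurableT_comp mD measurable_fst).
have Psi0 tx : (0 <= Psi tx)%E.
  by rewrite /Psi lee_fin mulr_ge0 //; case: tx => t x; exact: Phi_ge0.
have := fubini_tonelli (m1 := leb) (m2 := mu) Psi mPsi Psi0.
have -> : (\int[leb]_t \int[mu]_x Psi (t, x) =
    \int[leb]_(t in D) \int[mu]_x (Phi n (t, x))%:E)%E.
  rewrite [RHS]integral_mkcond; apply: eq_integral => t _; rewrite patchE.
  case: ifPn => tD.
    by apply: eq_integral => x _; rewrite /Psi indicE tD mul1r.
  by rewrite integral0_eq // => x _; rewrite /Psi indicE (negPf tD) mul0r.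
move=> ->.
have [i1 e1] := Rintegral_birkhoff_Nfun n.
rewrite -e1 /Rintegral fineK; last exact: integrable_fin_num.
apply: eq_integral => x _; rewrite -mean_Phi [RHS]integral_mkcond.
apply: eq_integral => t _; rewrite /Psi patchE indicE.
by case: ifPn => tD; rewrite ?tD ?(negPf tD) ?mul1r ?mul0r.
Qed.

Lemma measurable_twist_rate n : measurable_fun [set: Rm] (a n).
Proof.
apply: measurable_funM => //.
have mP : measurable_fun [set: Rm * X] (EFin \o Phi n).
  by apply/measurable_EFinP; exact: measurable_Phi.
have P0 tx : (0 <= (EFin \o Phi n) tx)%E.
  by rewrite lee_fin; case: tx => t x; exact: Phi_ge0.
have := measurable_fun_fubini_tonelli_F (m2 := mu) (EFin \o Phi n) mP P0.
rewrite /fubini_F => mF; apply/measurable_EFinP.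
rewrite (_ : (EFin \o _) = (fun t => \int[mu]_x (EFin \o Phi n) (t, x))%E) //.
apply/funext => t /=; rewrite /Rintegral fineK //.
by apply: integrable_fin_num => //; exact: integrable_Phi.
Qed.

Lemma twist_rate_bounds n t : 0 <= a n t <= d%:R * \int[mu]_x ln (minorsum 1 (A x)).
Proof.
apply/andP; split.
  by rewrite mulr_ge0 ?invr_ge0 //; apply: Rintegral_ge0 => x _; exact: Phi_ge0.
have -> : \int[mu]_x ln (minorsum 1 (A x)) = \int[mu]_x ln (minorsum 1 (twist t x)).
  by apply: eq_Rintegral => x _; rewrite /twist minorsum1_Utheta.
exact: (Nfun_cocycle_le d0 hf (twist_Ugroup t) (measurable_mx_twist t)
  (integrable_ln_minorsum1_twist t) n).
Qed.

(** For every positive [n] the mean over the angle is exactly [J], so only the exchange of limit and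
    integral remains. *)
Lemma integral_twist_rate n : (0 < n)%N ->
  (\int[leb]_(t in `[0%R, 1%R]) (a n t)%:E = J%:E)%E.
Proof.
move=> n0.
transitivity (\int[leb]_(t in `[0%R, 1%R]) ((n%:R^-1)%:E * \int[mu]_x (Phi n (t, x))%:E))%E.
  apply: eq_integral => t _; rewrite /a EFinM; congr (_ * _)%E.
  by rewrite /Rintegral fineK //; apply: integrable_fin_num => //; exact: integrable_Phi.
rewrite ge0_integralZl //.
- by rewrite integral_Phi -EFinM mulrA mulVf ?mul1r // pnatr_eq0 -lt0n.
- apply: measurable_funTS.
  have mP : measurable_fun [set: Rm * X] (EFin \o Phi n).
    by apply/measurable_EFinP; exact: measurable_Phi.
  have P0 tx : (0 <= (EFin \o Phi n) tx)%E.
    by rewrite lee_fin; case: tx => t x; exact: Phi_ge0.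
  exact: (measurable_fun_fubini_tonelli_F (m2 := mu) (EFin \o Phi n) mP P0).
- by move=> t _; apply: integral_ge0 => x _; rewrite lee_fin; exact: Phi_ge0.
Qed.

Lemma integral_lyap_sum :
  (\int[leb]_(t in `[0%R, 1%R]) lyap_sum mu f (fun x => Utheta c d t *m A x) d =
   \int[mu]_x (Nfun d (A x))%:E)%E.
Proof.
have /choice[L hL] t := lyap_sum_cvg d0 hf (twist_Ugroup t) (measurable_mx_twist t)
  (integrable_ln_minorsum1_twist t).
have aL t : (fun n => a n t) @ \oo --> L t by exact: (hL t).2.
have mL : measurable_fun [set: Rm] L.
  apply: (measurable_fun_cvg (h := a)) => [n|t _]; first exact: measurable_twist_rate.
  exact: aL.
transitivity (\int[leb]_(t in `[0%R, 1%R]) (L t)%:E)%E.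
  by apply: eq_integral => t _; exact: (hL t).1.
(* The dominating function is constant in [t] and in [n], hence integrable over the unit
   interval. *)
have [] := @dominated_convergence _ (measurableTypeR R) R leb [set` `[0%R, 1%R]]
  (measurable_itv _) (fun n t => (a n t)%:E) (fun t => (L t)%:E)
  (fun _ => (d%:R * \int[mu]_x ln (minorsum 1 (A x)))%:E).
- move=> n; apply/measurable_EFinP; apply: measurable_funTS; exact: measurable_twist_rate.
- by apply/measurable_EFinP; exact: measurable_funTS.
- apply: aeW => t _; apply: cvg_EFin; first exact: nearW.
  exact: aL.
- by apply: continuous_itv_integrable => x; exact: cvg_cst.
- apply: aeW => t n _; rewrite lee_fin.
  by have /andP[a0 a1] := twist_rate_bounds n t; rewrite ger0_norm.
move=> _ _ h.
have J' : (\int[mu]_x (Nfun d (A x))%:E = J%:E)%E.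
  by rewrite /J /Rintegral fineK //; exact: integrable_fin_num integrable_Nfun_map.
rewrite J'; apply: (cvg_unique _ h) => //.
(* The integrals equal [J] from [n = 1] on; the term at [n = 0] is discarded. *)
apply: cvg_near_cst; near=> n; apply: integral_twist_rate.
by near: n; exists 1%N.
Unshelve. all: by end_near. Qed.

End Averaging.

Theorem theorem1p1 (R : realType) (c d : nat) (hc : (1 <= c)%N)
    (hd : (1 <= d)%N) (disp : measure_display) (X : measurableType disp)
    (mu : probability X R) (f : X -> X) (hf : measure_preserving mu f)
    (A : X -> 'M[R[i]]_(c + d)) (hA : forall x, Ugroup c d (A x))
    (mA : measurable_mx A)
    (iA : mu.-integrable [set: X] (fun x => (ln (opnorm (A x)))%:E)) :
  (\int[lebesgue_measure]_(t in `[0%R, 1%R])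
      lyap_sum mu f (fun x => Utheta c d t *m A x) d
   = \int[mu]_x (Nfun d (A x))%:E)%E.
Proof. exact: integral_lyap_sum. Qed.
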